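(* Consider the source-free Type IIA flow $\partial_t\varphi=d\Lambda d(|\varphi|^2\star\varphi)$ in the following two situations. (a) Let $M$ be a compact nilmanifold, the quotient by a co-compact lattice of the nilpotent Lie group with left-invariant coframe $e^1,\dots,e^6$ satisfying $de^1=de^2=de^3=de^5=0$, $de^4=e^{15}$, $de^6=e^{13}$, with symplectic form $\omega=e^{12}+e^{34}+e^{56}$. For the flow with positive initial data of the form $$\varphi_{a,b}=(1+a)e^{135}-e^{146}-e^{245}-e^{236}+b(e^{134}-e^{156}),\qquad a,b\in\mathbf R,$$ the flow exists for all time, and the Nijenhuis tensor of $J_\varphi$ tends to $0$ as $t\to\infty$. (b) Let $M$ be the compact solvmanifold, a quotient by a co-compact lattice of the solvable Lie group with left-invariant coframe $e^1,\dots,e^6$ satisfying $de^1=-\lambda e^{15}$, $de^2=\lambda e^{25}$, $de^3=-\lambda e^{36}$, $de^4=\lambda e^{46}$, $de^5=de^6=0$, where $\lambda=\log\frac{3+\sqrt5}2$, with symplectic form $\omega=e^{12}+e^{34}+e^{56}$. For the flow with positive initial data of the form $$\varphi=\alpha(e^{135}+e^{136})+\beta(e^{145}-e^{146})+\gamma(e^{235}-e^{236})-\delta(e^{245}+e^{246}),\qquad \alpha,\beta,\gamma,\delta\in\mathbf R,$$ the flow develops a singularity at a finite time $T$. However, the limit of $J_\varphi$ as $t\to T$ exists, and is a harmonic almost-complex structure.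
   Context: Notation: $e^{ij}=e^i\wedge e^j$, etc.; forms as in (a), (b) are closed and primitive. Type IIA conventions on a symplectic $6$-manifold $(M,\omega)$, oriented by $\omega^3$. For a $3$-form $\varphi$ set, pointwise, $K_\varphi(v)=-\sum_i e_i\otimes(e^i\wedge\iota_v\varphi\wedge\varphi)\in TM\otimes\Lambda^6T^*M$ and $\lambda_\varphi=\frac16\mathrm{tr}\,K_\varphi^2$. If $\lambda_\varphi<0$, then $J_\varphi=K_\varphi/\sqrt{-\lambda_\varphi}$ (positive root) is an almost-complex structure (Hitchin). $\Lambda$ is contraction with $\omega$: $(\Lambda\alpha)_{k\cdots}=\frac12\omega^{ji}\alpha_{ijk\cdots}$, $\omega^{jk}\omega_{kl}=\delta^j{}_l$. $\varphi$ is primitive if $\Lambda\varphi=0$; then $g_\varphi(X,Y)=\omega(X,J_\varphi Y)$ is symmetric. $\varphi$ is positive if $\lambda_\varphi<0$ and $g_\varphi$ is positive definite. $\star$ and $|\varphi|$ ($|\varphi|^2=\frac16\varphi_{ijk}\varphi^{ijk}$) are with respect to $g_\varphi$. The Nijenhuis tensor is $N(X,Y)=\frac14([JX,JY]-J[JX,Y]-J[X,JY]-[X,Y])$; ''$N$ tends to $0$'' means that its norm $|N|$ with respect to the evolving metric $g_\varphi$ tends to $0$. An almost-complex structure $J$ compatible with $\omega$ (with metric $g(X,Y)=\omega(X,JY)$) is harmonic (in the sense of Blair-Ianus) if the $J$-anti-invariant part of the Ricci curvature of $g$ vanishes: $\frac12(R_{ij}-R_{kl}J^k{}_iJ^l{}_j)=0$.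 *)

(* Defs.v *)
(* MathComp-Analysis, over an arbitrary [R : realType].

   A simply connected nilpotent or solvable Lie group of dimension 6 is
   diffeomorphic to R^6; it is modelled as a smooth group law on ['rV[R]_6].
   A tensor field on the quotient [Gamma \ G] is a [Gamma]-invariant tensor
   field on [G], and it is given throughout by its components in the global
   left-invariant coframe e^1, ..., e^6, which descends to the quotient.  The
   components are arbitrary functions of the point; they are constant exactly
   when the tensor field is left-invariant. *)
From HB Require Import structures.
From mathcomp Require Import all_boot all_order all_algebra.
From mathcomp Require Import all_classical all_reals all_analysis.
Set Implicit Arguments.
Unset Strict Implicit.
Unset Printing Implicit Defensive.
Import Order.TTheory GRing.Theory Num.Theory.
Import numFieldNormedType.Exports.
Local Open Scope classical_set_scope.
Local Open Scope ring_scope.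

Fixpoint Ck_on (R : realType) (V W : normedModType R) (k : nat) (U : set V)
    (f : V -> W) : Prop :=
  match k with
  | 0 => forall x, U x -> {for x, continuous f}
  | k'.+1 => (forall x, U x -> differentiable f x) /\
             (forall v, Ck_on k' U (fun x => 'D_v f x))
  end.

(* [U] is always open below. *)
Definition smooth_on (R : realType) (V W : normedModType R) (U : set V)
    (f : V -> W) : Prop := forall k, Ck_on k U f.

Definition smooth (R : realType) (V W : normedModType R) (f : V -> W) : Prop :=
  smooth_on setT f.

Record lie_group (R : realType) := LieGroup {
  gmul : 'rV[R]_6 -> 'rV[R]_6 -> 'rV[R]_6;
  gone : 'rV[R]_6;
  ginv : 'rV[R]_6 -> 'rV[R]_6;
  gmulA : forall x y z, gmul x (gmul y z) = gmul (gmul x y) z;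
  gmul1l : forall x, gmul gone x = x;
  gmul1r : forall x, gmul x gone = x;
  gmulVl : forall x, gmul (ginv x) x = gone;
  gmulVr : forall x, gmul x (ginv x) = gone;
  gmul_smooth :
    smooth (fun p : ('rV[R]_6 * 'rV[R]_6)%type => gmul p.1 p.2);
  ginv_smooth : smooth ginv }.

Definition cocompact_lattice (R : realType) (G : lie_group R)
    (Gamma : set 'rV[R]_6) : Prop :=
  [/\ [/\ Gamma (gone G),
          (forall x y, Gamma x -> Gamma y -> Gamma (gmul G x y)) &
          (forall x, Gamma x -> Gamma (ginv G x))],
      (exists2 U, nbhs (gone G) U &
         forall x, U x -> Gamma x -> x = gone G) &
      (exists2 K : set 'rV[R]_6, compact K &
         forall x, exists g k, [/\ Gamma g, K k & x = gmul G g k])].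

(* Column [i] of [e x] is the covector e^{i+1} at [x], so that
   [(v *m e x) 0 i] is its value on the tangent vector [v]. *)
Definition coframe (R : realType) := 'rV[R]_6 -> 'M[R]_6.

Definition left_invariant_coframe (R : realType) (G : lie_group R)
    (e : coframe R) : Prop :=
  [/\ (forall a i, smooth (fun x => e x a i : R^o)),
      (forall x, e x \in unitmx) &
      (forall g x v, 'D_v (gmul G g) x *m e (gmul G g x) = v *m e x)].

Definition frame (R : realType) (e : coframe R) (i : 'I_6) (x : 'rV[R]_6) :
    'rV[R]_6 := row i (invmx (e x)).

Definition frame_deriv (R : realType) (e : coframe R) (i : 'I_6)
    (f : 'rV[R]_6 -> R) (x : 'rV[R]_6) : R := 'D_(frame e i x) (f : _ -> R^o) x.

(* [dcoframe e x k i j] is de^k evaluated on the frame vectors e_i, e_j: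
   d alpha (u, v) = D_u (alpha v) - D_v (alpha u) for fixed u, v in R^6.
   Equivalently [e_i, e_j] = - \sum_k (dcoframe e x k i j) e_k. *)
Definition dcoframe (R : realType) (e : coframe R) (x : 'rV[R]_6)
    (k i j : 'I_6) : R :=
  let u := frame e i x in let v := frame e j x in
  'D_u (fun y => (v *m e y) 0 k : R^o) x
  - 'D_v (fun y => (u *m e y) 0 k : R^o) x.

(* Values at one point of forms and tensors, in components: 2-forms are
   antisymmetric matrices, and an endomorphism A is the matrix with
   A e_i = \sum_k (A k i) e_k. *)
Definition form3 (R : realType) := 'I_6 -> 'I_6 -> 'I_6 -> R.
Definition form4 (R : realType) := 'I_6 -> 'I_6 -> 'I_6 -> 'I_6 -> R.

Definition alternating (R : realType) (phi : form3 R) : Prop :=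
  forall i j k, phi j i k = - phi i j k /\ phi i k j = - phi i j k.

(* The basis forms e^{ab} and e^{abc}, with labels running from 1 to 6. *)
Definition e2 (R : realType) (a b : nat) : 'M[R]_6 :=
  \matrix_(i, j) \det (\matrix_(p < 2, q < 2)
    ((nth i [:: i; j] p).+1 == nth 0%N [:: a; b] q)%:R).

Definition e3 (R : realType) (a b c : nat) : form3 R := fun i j k =>
  \det (\matrix_(p < 3, q < 3)
    ((nth i [:: i; j; k] p).+1 == nth 0%N [:: a; b; c] q)%:R).

Definition omega (R : realType) : 'M[R]_6 := e2 R 1 2 + e2 R 3 4 + e2 R 5 6.

Fixpoint inversions (s : seq nat) : nat :=
  if s is a :: s' then (count (fun b => (b < a)%N) s' + inversions s')%N
  else 0%N.

(* The Levi-Civita symbol, normalised by the orientation omega^3 = 6 e^{123456}. *)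
Definition levi_civita (R : realType) (i j k l m n : 'I_6) : R :=
  let s := map val [:: i; j; k; l; m; n] in
  if uniq s then (-1) ^+ inversions s else 0.

(* Lambda^6 T^*M is trivialised by e^{123456}.  Entry (i, v) is minus the
   coefficient of e^i /\ iota_{e_v} phi /\ phi; the factor 1/12 is 1/(1! 2! 3!). *)
Definition K_form (R : realType) (phi : form3 R) : 'M[R]_6 :=
  \matrix_(i, v) - (12%:R^-1 * \sum_j \sum_k \sum_l \sum_m \sum_n
    levi_civita R i j k l m n * phi v j k * phi l m n).

Definition lambda_form (R : realType) (phi : form3 R) : R :=
  6%:R^-1 * \tr (K_form phi *m K_form phi).

Definition J_form (R : realType) (phi : form3 R) : 'M[R]_6 :=
  (Num.sqrt (- lambda_form phi))^-1 *: K_form phi.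

Definition metric_of (R : realType) (J : 'M[R]_6) : 'M[R]_6 := omega R *m J.

Definition g_form (R : realType) (phi : form3 R) : 'M[R]_6 :=
  metric_of (J_form phi).

Definition posdef (R : realType) (g : 'M[R]_6) : Prop :=
  g^T = g /\ forall v : 'rV[R]_6, v != 0 -> 0 < (v *m g *m v^T) 0 0.

Definition Lambda3 (R : realType) (phi : form3 R) (k : 'I_6) : R :=
  2%:R^-1 * \sum_i \sum_j invmx (omega R) j i * phi i j k.

Definition Lambda4 (R : realType) (alpha : form4 R) : 'M[R]_6 :=
  \matrix_(k, l) (2%:R^-1 * \sum_i \sum_j invmx (omega R) j i * alpha i j k l).

Definition primitive (R : realType) (phi : form3 R) : Prop :=
  forall k, Lambda3 phi k = 0.

Definition positive (R : realType) (phi : form3 R) : Prop :=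
  [/\ primitive phi, lambda_form phi < 0 & posdef (g_form phi)].

Definition raise3 (R : realType) (g : 'M[R]_6) (phi : form3 R) : form3 R :=
  fun i j k => \sum_a \sum_b \sum_c
    invmx g i a * invmx g j b * invmx g k c * phi a b c.

Definition norm2_form (R : realType) (phi : form3 R) : R :=
  6%:R^-1 * \sum_i \sum_j \sum_k phi i j k * raise3 (g_form phi) phi i j k.

Definition star (R : realType) (phi : form3 R) : form3 R := fun l m n =>
  6%:R^-1 * Num.sqrt (\det (g_form phi)) * \sum_i \sum_j \sum_k
    levi_civita R i j k l m n * raise3 (g_form phi) phi i j k.

(* Exterior derivative of forms with variable components, in the frame. *)
Definition d2 (R : realType) (e : coframe R) (b : 'rV[R]_6 -> 'M[R]_6)
    (x : 'rV[R]_6) : form3 R := fun i j k =>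
  frame_deriv e i (fun y => b y j k) x - frame_deriv e j (fun y => b y i k) x
  + frame_deriv e k (fun y => b y i j) x
  + \sum_l (dcoframe e x l i j * b x l k - dcoframe e x l i k * b x l j
            + dcoframe e x l j k * b x l i).

Definition d3 (R : realType) (e : coframe R) (phi : 'rV[R]_6 -> form3 R)
    (x : 'rV[R]_6) : form4 R := fun i j k l =>
  frame_deriv e i (fun y => phi y j k l) x
  - frame_deriv e j (fun y => phi y i k l) x
  + frame_deriv e k (fun y => phi y i j l) x
  - frame_deriv e l (fun y => phi y i j k) x
  + \sum_m (dcoframe e x m i j * phi x m k l - dcoframe e x m i k * phi x m j l
            + dcoframe e x m i l * phi x m j k + dcoframe e x m j k * phi x m i l
            - dcoframe e x m j l * phi x m i k + dcoframe e x m k l * phi x m i j).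

Definition closed3 (R : realType) (e : coframe R) (phi : 'rV[R]_6 -> form3 R) :
    Prop := forall x i j k l, d3 e phi x i j k l = 0.

Definition typeIIA_rhs (R : realType) (e : coframe R)
    (phi : 'rV[R]_6 -> form3 R) : 'rV[R]_6 -> form3 R :=
  d2 e (fun x => Lambda4 (d3 e
    (fun y i j k => norm2_form (phi y) * star (phi y) i j k) x)).

(* Smoothness on [0, T[ x R^6, up to the boundary t = 0. *)
Definition smooth_upto (R : realType) (T : \bar R) (f : R -> 'rV[R]_6 -> R) :
    Prop :=
  exists2 eps : R, 0 < eps &
  exists2 F : (R^o * 'rV[R]_6)%type -> R^o,
    smooth_on [set p | (- eps < p.1) /\ ((p.1 : R)%:E < T)%E] F &
    forall t x, 0 <= t -> (t%:E < T)%E -> F (t, x) = f t x.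

(* At t = 0 the equation follows by continuity. *)
Definition typeIIA_solution (R : realType) (G : lie_group R)
    (Gamma : set 'rV[R]_6) (e : coframe R) (T : \bar R)
    (phi : R -> 'rV[R]_6 -> form3 R) : Prop :=
  [/\ (forall i j k, smooth_upto T (fun t x => phi t x i j k)),
      (forall t, 0 <= t -> (t%:E < T)%E ->
        [/\ (forall g x i j k, Gamma g ->
               phi t (gmul G g x) i j k = phi t x i j k),
            (forall x, alternating (phi t x)),
            (forall x, positive (phi t x)) &
            closed3 e (phi t)]) &
      (forall t x i j k, 0 < t -> (t%:E < T)%E ->
        is_derive t (1 : R^o) (fun s : R^o => phi s x i j k : R^o)
                  (typeIIA_rhs e (phi t) x i j k))].

Definition agree_before (R : realType) (T : \bar R)
    (phi psi : R -> 'rV[R]_6 -> form3 R) : Prop :=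
  forall t x i j k, 0 <= t -> (t%:E < T)%E -> phi t x i j k = psi t x i j k.

(* [phi] on [0, T[ is the maximal solution on [Gamma \ G] starting at the
   left-invariant form [phi0]: it cannot be continued past [T], and every
   left-invariant solution with the same initial value coincides with it. *)
Definition typeIIA_flow (R : realType) (G : lie_group R)
    (Gamma : set 'rV[R]_6) (e : coframe R) (phi0 : form3 R) (T : \bar R)
    (phi : R -> 'rV[R]_6 -> form3 R) : Prop :=
  [/\ (0 < T)%E /\ typeIIA_solution G Gamma e T phi,
      (forall x i j k, phi 0 x i j k = phi0 i j k),
      (forall T' psi, (T < T')%E -> typeIIA_solution G Gamma e T' psi ->
         ~ agree_before T psi phi) &
      (forall T' psi, typeIIA_solution G Gamma e T' psi ->
         (forall t x y i j k, 0 <= t -> (t%:E < T')%E ->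
            psi t x i j k = psi t y i j k) ->
         (forall x i j k, psi 0 x i j k = phi0 i j k) ->
         agree_before (Order.min T T') psi phi)].

(* Vector fields are given by their components in the frame. *)
Definition lie_bracket (R : realType) (e : coframe R)
    (X Y : 'rV[R]_6 -> 'rV[R]_6) (x : 'rV[R]_6) : 'rV[R]_6 :=
  \row_k (\sum_i (X x 0 i * frame_deriv e i (fun y => Y y 0 k) x
                  - Y x 0 i * frame_deriv e i (fun y => X y 0 k) x)
          - \sum_i \sum_j X x 0 i * Y x 0 j * dcoframe e x k i j).

(* The vector N(e_j, e_k). *)
Definition nijenhuis (R : realType) (e : coframe R)
    (J : 'rV[R]_6 -> 'M[R]_6) (x : 'rV[R]_6) (j k : 'I_6) : 'rV[R]_6 :=
  let app (Z : 'rV[R]_6 -> 'rV[R]_6) := fun y => Z y *m (J y)^T in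
  let X := fun _ => delta_mx 0 j in let Y := fun _ => delta_mx 0 k in
  4%:R^-1 *: (lie_bracket e (app X) (app Y) x
              - app (lie_bracket e (app X) Y) x
              - app (lie_bracket e X (app Y)) x
              - lie_bracket e X Y x).

Definition nijenhuis_norm (R : realType) (e : coframe R)
    (phi : 'rV[R]_6 -> form3 R) (x : 'rV[R]_6) : R :=
  let g := g_form (phi x) in
  let N i j k := nijenhuis e (fun y => J_form (phi y)) x j k 0 i in
  Num.sqrt (\sum_i \sum_j \sum_k \sum_a \sum_b \sum_c
    g i a * invmx g j b * invmx g k c * N i j k * N a b c).

(* Levi-Civita connection, nabla_{e_i} e_j = \sum_l (christoffel e g x i j l) e_l,
   from the Koszul formula. *)
Definition christoffel (R : realType) (e : coframe R)
    (g : 'rV[R]_6 -> 'M[R]_6) (x : 'rV[R]_6) (i j l : 'I_6) : R :=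
  let br a b c := - \sum_m dcoframe e x m a b * g x m c in
  2%:R^-1 * \sum_k invmx (g x) l k *
    (frame_deriv e i (fun y => g y j k) x + frame_deriv e j (fun y => g y i k) x
     - frame_deriv e k (fun y => g y i j) x
     + br i j k - br i k j - br j k i).

(* Ric(Y, Z) = tr (X |-> nabla_X nabla_Y Z - nabla_Y nabla_X Z - nabla_[X,Y] Z). *)
Definition ricci (R : realType) (e : coframe R) (g : 'rV[R]_6 -> 'M[R]_6)
    (x : 'rV[R]_6) : 'M[R]_6 :=
  let C := christoffel e g in
  \matrix_(j, k) \sum_i
    (frame_deriv e i (fun y => C y j k i) x
     - frame_deriv e j (fun y => C y i k i) x
     + \sum_l (C x j k l * C x i l i - C x i k l * C x j l i
               + dcoframe e x l i j * C x l k i)).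

Definition harmonic_acs (R : realType) (G : lie_group R)
    (Gamma : set 'rV[R]_6) (e : coframe R) (J : 'rV[R]_6 -> 'M[R]_6) : Prop :=
  let Ric := ricci e (fun x => metric_of (J x)) in
  [/\ (forall k i, smooth (fun x => J x k i : R^o)),
      (forall g x, Gamma g -> J (gmul G g x) = J x),
      (forall x, J x *m J x = - 1%:M),
      (forall x, posdef (metric_of (J x))) &
      (forall x i j, 2%:R^-1 * (Ric x i j -
         \sum_k \sum_l Ric x k l * J x k i * J x l j) = 0)].

(* Convergence as t -> T, uniformly on the quotient together with all frame
   derivatives of all orders. *)
Definition cvg_at (R : realType) (e : coframe R) (T : R)
    (J : R -> 'rV[R]_6 -> 'M[R]_6) (Jlim : 'rV[R]_6 -> 'M[R]_6) : Prop :=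
  forall (s : seq 'I_6) (k i : 'I_6) (eps : R), 0 < eps ->
  exists2 t0 : R, t0 < T & forall t x, t0 < t -> t < T ->
    `|foldr (frame_deriv e) (fun y => J t y k i - Jlim y k i) s x| < eps.

Definition structure_equations (R : realType) (e : coframe R)
    (de : seq 'M[R]_6) : Prop :=
  forall x k i j, dcoframe e x k i j = (nth 0 de k) i j.

Definition nil_structure (R : realType) : seq 'M[R]_6 :=
  [:: 0; 0; 0; e2 R 1 5; 0; e2 R 1 3].

Definition sol_constant (R : realType) : R :=
  ln ((3%:R + Num.sqrt 5%:R) / 2%:R).

Definition sol_structure (R : realType) : seq 'M[R]_6 :=
  let lam := sol_constant R in
  [:: - lam *: e2 R 1 5; lam *: e2 R 2 5; - lam *: e2 R 3 6; lam *: e2 R 4 6;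
      0; 0].

Definition nil_form (R : realType) (a b : R) : form3 R := fun i j k =>
  (1 + a) * e3 R 1 3 5 i j k - e3 R 1 4 6 i j k - e3 R 2 4 5 i j k
  - e3 R 2 3 6 i j k + b * (e3 R 1 3 4 i j k - e3 R 1 5 6 i j k).

Definition sol_form (R : realType) (al be ga de : R) : form3 R := fun i j k =>
  al * (e3 R 1 3 5 i j k + e3 R 1 3 6 i j k)
  + be * (e3 R 1 4 5 i j k - e3 R 1 4 6 i j k)
  + ga * (e3 R 2 3 5 i j k - e3 R 2 3 6 i j k)
  - de * (e3 R 2 4 5 i j k + e3 R 2 4 6 i j k).

(* Main.v *)
From HB Require Import structures.
From Stdlib Require Import BinInt.
From Stdlib Require QArith.
From mathcomp Require Import all_boot all_order all_algebra.
From mathcomp Require Import ssrZ ring lra.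
From mathcomp Require Import all_classical all_reals all_analysis.
Require Import Defs.
Set Implicit Arguments.
Unset Strict Implicit.
Unset Printing Implicit Defensive.
Import Order.TTheory GRing.Theory Num.Theory.
Import numFieldNormedType.Exports.
Local Open Scope classical_set_scope.
Local Open Scope ring_scope.

(** Both families of initial data are left-invariant, and on left-invariant
    forms every operator in the flow is algebraic in the components: the flow
    is an ordinary differential equation [phi' = linv_flow dc phi] on the
    3-forms over R^6, and it preserves both families.

    Case (a).  Put D = 1 + a - b^2, so that lambda = - 4 D ([nil_lambda]) and
    positivity of the initial form gives D > 0.  The right-hand side of the flow
    at phi_{a,b} is the constant form 8 e^{135} ([nil_flow]).  Hence b is
    constant, a grows linearly, D tends to infinity, and
    |N|^2 = D^{-3/2} tends to 0 ([nil_nijenhuis_norm2]).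

    Case (b).  The equation is al' = (c/2) al (be ga), be' = (c/2) be (al de),
    ga' = (c/2) ga (al de), de' = (c/2) de (be ga) with c = 32 lambda^2
    ([sol_flow]).  The products P = al de and Q = be ga are positive and satisfy
    P' = Q' = c P Q, so that P - Q is constant and P, Q blow up at a finite time
    T ([blow_up_profile]).  Since J is unchanged when the form is rescaled
    ([J_form_scale]), the blow-up is harmless for J: after division by
    1 / sqrt h, where h vanishes at T, the form converges to a member of
    the same family with al de = be ga.  There the Ricci tensor is a multiple of
    (e^5)^2 + (e^6)^2 and J maps e_5 to e_6, whence harmonicity
    ([sol_ricci_invariant]).

    The pointwise tensor identities are polynomial identities in the
    parameters, once the square roots involved are named as extra variables.
    They are established by running the definitions on polynomial entries, with
    a soundness lemma for every tensor operation.

    Uniqueness among all left-invariant solutions, also those outside of the two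
    families, comes from Gronwall's inequality ([gronwall]).  The Lipschitz
    bound it needs is obtained along the two solutions to be compared, on a
    compact time interval: the pairs of functions whose difference is bounded by
    the distance of the two forms are closed under sums, products, inverses and
    square roots ([lip_pair], [lip_flow]). *)

(** * Sparse polynomials with rational coefficients *)

Definition coef := QArith_base.Q.

(** Exponents of the successive variables, without trailing zeros. *)
Definition mono := seq nat.

(** Kept sorted and free of zero terms, which makes the zero polynomial the
    empty list. *)
Definition pol := seq (coef * mono).

Fixpoint madd (m n : mono) : mono :=
  match m, n with
  | [::], _ => n
  | _, [::] => m
  | a :: m', b :: n' => (a + b)%N :: madd m' n'
  end.

Fixpoint mlt (m n : mono) : bool :=
  match m, n with
  | [::], [::] => false
  | [::], _ => true
  | _, [::] => false
  | a :: m', b :: n' => (a < b)%N || ((a == b) && mlt m' n')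
  end.

Definition ciszero (c : coef) : bool := Z.eqb (QArith_base.Qnum c) 0.

Definition cadd (c d : coef) := Qreduction.Qred (QArith_base.Qplus c d).
Definition cmul (c d : coef) := Qreduction.Qred (QArith_base.Qmult c d).

Definition pcons (c : coef) (m : mono) (p : pol) : pol :=
  if ciszero c then p else (c, m) :: p.

Fixpoint pins (c : coef) (m : mono) (p : pol) : pol :=
  if p is (d, n) :: p' then
    if m == n then pcons (cadd c d) m p'
    else if mlt m n then pcons c m p else (d, n) :: pins c m p'
  else pcons c m [::].

Definition padd (p q : pol) : pol := foldr (fun cm r => pins cm.1 cm.2 r) q p.

Definition pscale (c : coef) (m : mono) (p : pol) : pol :=
  [seq (cmul c dn.1, madd m dn.2) | dn <- p].

Definition pmul (p q : pol) : pol :=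
  foldr (fun cm r => padd (pscale cm.1 cm.2 q) r) [::] p.

(** The second factor is suspended, so that a zero first factor cuts the
    evaluation short. *)
Definition lmul (p : pol) (q : unit -> pol) : pol :=
  if p is [::] then [::] else pmul p (q tt).

Definition pconst (c : coef) : pol := pcons c [::] [::].
Definition pint (z : Z) : pol := pconst (QArith_base.inject_Z z).
Definition pfrac (d : BinNums.positive) : pol := pconst (QArith_base.Qmake 1 d).
Definition pvar (i : nat) : pol :=
  [:: (QArith_base.inject_Z 1, rcons (nseq i 0%N) 1%N)].
Definition popp (p : pol) : pol := pscale (QArith_base.inject_Z (-1)) [::] p.
Definition psub (p q : pol) : pol := padd p (popp q).

Fixpoint msub (m n : mono) : option mono :=
  match m, n with
  | _, [::] => Some m
  | [::], _ => if all (pred1 0%N) n then Some [::] else None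
  | a :: m', b :: n' =>
      if (b <= a)%N then
        if msub m' n' is Some r then
          Some (if ((a - b)%N == 0%N) && (r == [::]) then [::]
                else (a - b)%N :: r)
        else None
      else None
  end.

Fixpoint mdiv (k : nat) (n m : mono) : mono :=
  if k is k'.+1 then if msub m n is Some r then mdiv k' n r else m else m.

(** Square roots and inverses enter the computations as additional variables,
    tied to the other ones by relations of the form monomial = 1.  The degree of
    a monomial bounds how often it can be divided. *)
Definition mred (ms : seq mono) (m : mono) : mono :=
  foldr (fun n r => mdiv (sumn r) n r) m ms.

Definition preduce (ms : seq mono) (p : pol) : pol :=
  foldr (fun cm r => pins cm.1 (mred ms cm.2) r) [::] p.

Definition peq_mod (ms : seq mono) (p q : pol) : bool :=
  nilp (preduce ms (psub p q)).

Definition psum (f : nat -> pol) : pol :=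
  foldr (fun i r => padd (f i) r) [::] (iota 0 6).

Definition all6 (P : nat -> bool) : bool := all P (iota 0 6).

(** Tabulation makes call-by-value evaluation compute every entry once. *)
Definition tab2 (f : nat -> nat -> pol) : nat -> nat -> pol :=
  let t := [seq [seq f i j | j <- iota 0 6] | i <- iota 0 6] in
  fun i j => nth [::] (nth [::] t i) j.

Definition tab3 (f : nat -> nat -> nat -> pol) : nat -> nat -> nat -> pol :=
  let t := [seq [seq [seq f i j k | k <- iota 0 6] | j <- iota 0 6]
           | i <- iota 0 6] in
  fun i j k => nth [::] (nth [::] (nth [::] t i) j) k.

Definition tab4 (f : nat -> nat -> nat -> nat -> pol) :
    nat -> nat -> nat -> nat -> pol :=
  let t := [seq [seq [seq [seq f i j k l | l <- iota 0 6] | k <- iota 0 6]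
           | j <- iota 0 6] | i <- iota 0 6] in
  fun i j k l => nth [::] (nth [::] (nth [::] (nth [::] t i) j) k) l.

Section Evaluation.
Variables (R : realType) (env : seq R).

Definition zev (z : Z) : R := (int_of_Z z)%:~R.

Definition cev (c : coef) : R :=
  zev (QArith_base.Qnum c) / zev (Zpos (QArith_base.Qden c)).

Fixpoint mev (env : seq R) (m : mono) : R :=
  match m, env with
  | a :: m', x :: env' => x ^+ a * mev env' m'
  | _, _ => 1
  end.

Definition pev (p : pol) : R :=
  foldr (fun cm r => cev cm.1 * mev env cm.2 + r) 0 p.

Lemma zevD (a b : Z) : zev (Z.add a b) = zev a + zev b.
Proof. by rewrite /zev -intrD; congr (_%:~R); exact: (rmorphD int_of_Z). Qed.

Lemma zevM (a b : Z) : zev (Z.mul a b) = zev a * zev b.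
Proof. by rewrite /zev -intrM; congr (_%:~R); exact: (rmorphM int_of_Z). Qed.

Lemma zev_pos (p : BinNums.positive) : zev (Zpos p) != 0.
Proof.
rewrite /zev intr_eq0 /=.
by have := Pos2Nat.is_pos p; case: (Pos.to_nat p) => // /PeanoNat.Nat.lt_irrefl.
Qed.

Lemma cev_eq (c d : coef) : QArith_base.Qeq c d -> cev c = cev d.
Proof.
rewrite /QArith_base.Qeq /cev => h; apply/eqP.
by rewrite eqr_div ?zev_pos// -!zevM h.
Qed.

Lemma cevD c d : cev (cadd c d) = cev c + cev d.
Proof.
rewrite /cadd (cev_eq (Qreduction.Qred_correct _)) /cev /=.
by rewrite zevD !zevM Pos2Z.inj_mul zevM addf_div ?zev_pos.
Qed.

Lemma cevM c d : cev (cmul c d) = cev c * cev d.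
Proof.
rewrite /cmul (cev_eq (Qreduction.Qred_correct _)) /cev /=.
by rewrite zevM Pos2Z.inj_mul zevM mulf_div.
Qed.

Lemma cev_zero c : ciszero c -> cev c = 0.
Proof. by rewrite /ciszero /cev => /Z.eqb_eq ->; rewrite /zev /= mul0r. Qed.

Lemma cev_int z : cev (QArith_base.inject_Z z) = zev z.
Proof. by rewrite /cev /= {2}/zev /= divr1. Qed.

Lemma mev_nil (e : seq R) : mev e [::] = 1.
Proof. by case: e. Qed.

Lemma mev_add m n : mev env (madd m n) = mev env m * mev env n.
Proof.
elim: m n env => [|a m IH] [|b n] [|x e] //=; rewrite ?mul1r ?mulr1//.
by rewrite IH exprD; ring.
Qed.

Lemma mev_zero (e : seq R) m : all (pred1 0%N) m -> mev e m = 1.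
Proof.
elim: m e => [|a m IH] [|x e] //= /andP[/eqP-> h].
by rewrite expr0 mul1r IH.
Qed.

Lemma mev_sub (e : seq R) m n r :
  msub m n = Some r -> mev e m = mev e r * mev e n.
Proof.
elim: n m r e => [|b n IH] m r e.
  by case: m => [|a m] /= [<-]; rewrite mev_nil mulr1.
case: m => [|a m].
  rewrite /msub; case: ifP => // h [<-].
  by rewrite (mev_zero e h) !mev_nil mulr1.
rewrite /=; case: leqP => // ba; case E: msub => [r'|] // [<-].
case: e => [|x e]; first by case: ifP; rewrite mulr1.
rewrite /= (IH _ _ e E); case: ifP => /= [/andP[/eqP ab /eqP ->]|_].
  have -> : a = b by apply/eqP; rewrite eqn_leq ba -subn_eq0 ab.
  by rewrite mev_nil !mul1r.
by rewrite -{1}(subnK ba) exprD; ring.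
Qed.

Lemma mev_div k n m : mev env n = 1 -> mev env (mdiv k n m) = mev env m.
Proof.
move=> n1; elim: k m => [|k IH] m //=; case E: msub => [r|] //.
by rewrite IH (mev_sub env E) n1 mulr1.
Qed.

Definition relations (ms : seq mono) := forall n, n \in ms -> mev env n = 1.

Lemma mev_red ms m : relations ms -> mev env (mred ms m) = mev env m.
Proof.
elim: ms => [|n ms IH] //= h; rewrite mev_div; last by apply: h; rewrite mem_head.
by apply: IH => n' n'in; apply: h; rewrite inE n'in orbT.
Qed.

Lemma pev_cons c m p : pev (pcons c m p) = cev c * mev env m + pev p.
Proof.
by rewrite /pcons; case: ifP => // /cev_zero ->; rewrite mul0r add0r.
Qed.

Lemma pev_ins c m p : pev (pins c m p) = cev c * mev env m + pev p.
Proof.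
elim: p => [|[d n] p IH] /=; first by rewrite pev_cons.
case: eqP => [->|_]; first by rewrite pev_cons cevD; ring.
by case: ifP => _; rewrite ?pev_cons//= IH; ring.
Qed.

Lemma pevD p q : pev (padd p q) = pev p + pev q.
Proof.
elim: p => [|[c m] p IH] /=; first by rewrite add0r.
by rewrite pev_ins IH /= addrA.
Qed.

Lemma pev_scale c m p : pev (pscale c m p) = cev c * mev env m * pev p.
Proof.
elim: p => [|[d n] p IH] /=; first by rewrite mulr0.
by rewrite IH cevM mev_add; ring.
Qed.

Lemma pevM p q : pev (pmul p q) = pev p * pev q.
Proof.
elim: p => [|[c m] p IH] /=; first by rewrite mul0r.
by rewrite pevD IH pev_scale /=; ring.
Qed.

Lemma pev_lmul p q : pev (lmul p q) = pev p * pev (q tt).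
Proof. by case: p => [|cm p]; [rewrite /= mul0r | exact: pevM]. Qed.

Lemma pev_const c : pev (pconst c) = cev c.
Proof. by rewrite /pconst pev_cons mev_nil /= addr0 mulr1. Qed.

Lemma pev_int z : pev (pint z) = zev z.
Proof. by rewrite /pint pev_const cev_int. Qed.

Lemma pev_frac d : pev (pfrac d) = (zev (Zpos d))^-1.
Proof. by rewrite /pfrac pev_const /cev /= /zev /= mul1r. Qed.

Lemma mev_var i : (i < size env)%N ->
  mev env (rcons (nseq i 0%N) 1%N) = nth 0 env i.
Proof.
elim: i env => [|i IH] [|x e] //= h; first by rewrite mev_nil expr1 mulr1.
by rewrite expr0 mul1r IH.
Qed.

Lemma pev_var i : (i < size env)%N -> pev (pvar i) = nth 0 env i.
Proof.
by move=> h; rewrite /pvar /= cev_int mev_var// /zev /= mul1r addr0.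
Qed.

Lemma pevN p : pev (popp p) = - pev p.
Proof. by rewrite pev_scale cev_int mev_nil /zev /= mulr1 mulrN1z mulNr mul1r. Qed.

Lemma pevB p q : pev (psub p q) = pev p - pev q.
Proof. by rewrite pevD pevN. Qed.

Lemma pev_sum f : pev (psum f) = \sum_(i < 6) pev (f i).
Proof.
rewrite -(big_mkord xpredT (fun i => pev (f i))) /psum /index_iota subn0.
elim: (iota 0 6) => [|i s IH] /=; first by rewrite big_nil.
by rewrite pevD IH big_cons.
Qed.

Lemma pev_mod ms p : relations ms -> pev (preduce ms p) = pev p.
Proof.
move=> h; elim: p => [|[c m] p IH] //=.
by rewrite pev_ins mev_red// IH.
Qed.

Lemma peq_modP ms p q : relations ms -> peq_mod ms p q -> pev p = pev q.
Proof.
move=> h /nilP E; apply/eqP; rewrite -subr_eq0 -pevB -(pev_mod _ h) E.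
by [].
Qed.

End Evaluation.

Lemma all6P (P : nat -> bool) : all6 P -> forall i : 'I_6, P i.
Proof. by move=> /allP h i; apply: h; rewrite mem_iota /=. Qed.

Lemma tab2E f (i j : 'I_6) : tab2 f i j = f i j.
Proof.
by rewrite /tab2 (nth_map 0%N) ?size_iota// (nth_map 0%N) ?size_iota// !nth_iota.
Qed.

Lemma tab3E f (i j k : 'I_6) : tab3 f i j k = f i j k.
Proof.
rewrite /tab3 (nth_map 0%N) ?size_iota// (nth_map 0%N) ?size_iota//.
by rewrite (nth_map 0%N) ?size_iota// !nth_iota.
Qed.

Lemma tab4E f (i j k l : 'I_6) : tab4 f i j k l = f i j k l.
Proof.
rewrite /tab4 (nth_map 0%N) ?size_iota// (nth_map 0%N) ?size_iota//.
by rewrite (nth_map 0%N) ?size_iota// (nth_map 0%N) ?size_iota// !nth_iota.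
Qed.

(** * Component formulas for left-invariant tensors *)

(** On constant components the frame derivatives drop out of the formulas. *)
Definition linv_d3 (R : realType) (dc : 'I_6 -> 'I_6 -> 'I_6 -> R)
    (phi : form3 R) : form4 R := fun i j k l =>
  \sum_m (dc m i j * phi m k l - dc m i k * phi m j l
          + dc m i l * phi m j k + dc m j k * phi m i l
          - dc m j l * phi m i k + dc m k l * phi m i j).

Definition linv_d2 (R : realType) (dc : 'I_6 -> 'I_6 -> 'I_6 -> R)
    (b : 'M[R]_6) : form3 R := fun i j k =>
  \sum_l (dc l i j * b l k - dc l i k * b l j + dc l j k * b l i).

Definition linv_flow (R : realType) (dc : 'I_6 -> 'I_6 -> 'I_6 -> R)
    (phi : form3 R) : form3 R :=
  linv_d2 dc (Lambda4 (linv_d3 dc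
    (fun i j k => norm2_form phi * star phi i j k))).

Definition linv_nijenhuis (R : realType) (dc : 'I_6 -> 'I_6 -> 'I_6 -> R)
    (J : 'M[R]_6) (i j k : 'I_6) : R :=
  4%:R^-1 * (- (\sum_a \sum_b J a j * J b k * dc i a b)
             + \sum_m \sum_a J i m * J a j * dc m a k
             + \sum_m \sum_a J i m * J a k * dc m j a
             + dc i j k).

Definition linv_christoffel (R : realType) (dc : 'I_6 -> 'I_6 -> 'I_6 -> R)
    (g : 'M[R]_6) (i j l : 'I_6) : R :=
  let br a b c := - \sum_m dc m a b * g m c in
  2%:R^-1 * \sum_k invmx g l k * (br i j k - br i k j - br j k i).

Definition linv_ricci (R : realType) (dc : 'I_6 -> 'I_6 -> 'I_6 -> R)
    (g : 'M[R]_6) (j k : 'I_6) : R :=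
  let C := linv_christoffel dc g in
  \sum_i \sum_l (C j k l * C i l i - C i k l * C j l i + dc l i j * C l k i).

(** * Tensor operations on polynomial components *)

Definition pindex (b : bool) : pol := if b then pint 1 else [::].

Definition pe2 (a b i j : nat) : pol :=
  psub (pindex [&& i.+1 == a & j.+1 == b])
       (pindex [&& i.+1 == b & j.+1 == a]).

Definition pe3 (a b c i j k : nat) : pol :=
  psub (padd (padd (pindex [&& i.+1 == a, j.+1 == b & k.+1 == c])
                   (pindex [&& i.+1 == b, j.+1 == c & k.+1 == a]))
             (pindex [&& i.+1 == c, j.+1 == a & k.+1 == b]))
       (padd (padd (pindex [&& i.+1 == b, j.+1 == a & k.+1 == c])
                   (pindex [&& i.+1 == a, j.+1 == c & k.+1 == b]))
             (pindex [&& i.+1 == c, j.+1 == b & k.+1 == a])).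

Definition pomega (i j : nat) : pol :=
  padd (padd (pe2 1 2 i j) (pe2 3 4 i j)) (pe2 5 6 i j).

Definition plevi (i j k l m n : nat) : pol :=
  let s := [:: i; j; k; l; m; n] in
  if uniq s then if odd (inversions s) then pint (-1) else pint 1 else [::].

Definition pmx := nat -> nat -> pol.
Definition pform3 := nat -> nat -> nat -> pol.

Definition pK (ph : pform3) (i v : nat) : pol :=
  popp (pmul (pfrac 12) (psum (fun j => psum (fun k =>
    lmul (ph v j k) (fun _ => psum (fun l => psum (fun m => psum (fun n =>
      lmul (ph l m n) (fun _ => plevi i j k l m n))))))))).

Definition pmulmx (A B : pmx) (i j : nat) : pol :=
  psum (fun k => lmul (A i k) (fun _ => B k j)).

Definition ptrace (A : pmx) : pol := psum (fun i => A i i).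

Definition praise (gi : pmx) (ph : pform3) (i j k : nat) : pol :=
  psum (fun a => lmul (gi i a) (fun _ => psum (fun b => lmul (gi j b) (fun _ =>
    psum (fun c => lmul (gi k c) (fun _ => ph a b c)))))).

Definition pnorm2 (ph up : pform3) : pol :=
  pmul (pfrac 6) (psum (fun i => psum (fun j => psum (fun k =>
    lmul (ph i j k) (fun _ => up i j k))))).

(** Assumes that the metric has determinant 1. *)
Definition pstar (up : pform3) (l m n : nat) : pol :=
  pmul (pfrac 6) (psum (fun i => psum (fun j => psum (fun k =>
    lmul (up i j k) (fun _ => plevi i j k l m n))))).

Definition pd3 (dc ph : pform3) (i j k l : nat) : pol :=
  psum (fun m =>
    padd (psub (padd (padd (psub
      (lmul (dc m i j) (fun _ => ph m k l))
      (lmul (dc m i k) (fun _ => ph m j l)))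
      (lmul (dc m i l) (fun _ => ph m j k)))
      (lmul (dc m j k) (fun _ => ph m i l)))
      (lmul (dc m j l) (fun _ => ph m i k)))
      (lmul (dc m k l) (fun _ => ph m i j))).

Definition pLambda4 (al : nat -> nat -> nat -> nat -> pol) (k l : nat) : pol :=
  pmul (pfrac 2) (psum (fun i => psum (fun j =>
    lmul (popp (pomega j i)) (fun _ => al i j k l)))).

Definition pLambda3 (ph : pform3) (k : nat) : pol :=
  pmul (pfrac 2) (psum (fun i => psum (fun j =>
    lmul (popp (pomega j i)) (fun _ => ph i j k)))).

Definition pd2 (dc : pform3) (b : pmx) (i j k : nat) : pol :=
  psum (fun l =>
    padd (psub (lmul (dc l i j) (fun _ => b l k))
               (lmul (dc l i k) (fun _ => b l j)))
         (lmul (dc l j k) (fun _ => b l i))).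

Definition pnij (dc : pform3) (J : pmx) (i j k : nat) : pol :=
  pmul (pfrac 4)
    (padd (padd (padd
      (popp (psum (fun a => psum (fun b =>
         lmul (J a j) (fun _ => lmul (J b k) (fun _ => dc i a b))))))
      (psum (fun m => psum (fun a =>
         lmul (J i m) (fun _ => lmul (J a j) (fun _ => dc m a k))))))
      (psum (fun m => psum (fun a =>
         lmul (J i m) (fun _ => lmul (J a k) (fun _ => dc m j a))))))
      (dc i j k)).

Definition pnijnorm2 (g gi : pmx) (N : pform3) : pol :=
  psum (fun i => psum (fun j => psum (fun k => lmul (N i j k) (fun _ =>
    psum (fun a => lmul (g i a) (fun _ => psum (fun b => lmul (gi j b) (fun _ =>
      psum (fun c => lmul (gi k c) (fun _ => N a b c)))))))))).

Definition pchristoffel (dc : pform3) (g gi : pmx) (i j l : nat) : pol :=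
  let br a b c := popp (psum (fun m => lmul (dc m a b) (fun _ => g m c))) in
  pmul (pfrac 2) (psum (fun k => lmul (gi l k) (fun _ =>
    psub (psub (br i j k) (br i k j)) (br j k i)))).

Definition pricci (dc C : pform3) (j k : nat) : pol :=
  psum (fun i => psum (fun l =>
    padd (psub (lmul (C j k l) (fun _ => C i l i))
               (lmul (C i k l) (fun _ => C j l i)))
         (lmul (dc l i j) (fun _ => C l k i)))).

Fixpoint pdet (n : nat) (A : pmx) : pol :=
  if n is n'.+1 then
    foldr (fun j r => padd (lmul (A 0%N j) (fun _ =>
        pmul (if odd j then pint (-1) else pint 1)
             (pdet n' (fun i k => A i.+1 (bump j k))))) r) [::] (iota 0 n)
  else pint 1.

(** Every operation on real tensors is mirrored by the operation above on
    polynomial components; these lemmas carry a computation with polynomials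
    over to the tensors they represent. *)
Section Soundness.
Variables (R : realType) (env : seq R).
Local Notation ev := (pev env).

Local Opaque psum psub popp padd pmul lmul pint pfrac.

Definition rep2 (p : pmx) (A : 'I_6 -> 'I_6 -> R) :=
  forall i j : 'I_6, A i j = ev (p i j).
Definition rep3 (p : pform3) (f : 'I_6 -> 'I_6 -> 'I_6 -> R) :=
  forall i j k : 'I_6, f i j k = ev (p i j k).
Definition rep4 (p : nat -> nat -> nat -> nat -> pol)
    (f : 'I_6 -> 'I_6 -> 'I_6 -> 'I_6 -> R) :=
  forall i j k l : 'I_6, f i j k l = ev (p i j k l).

Lemma rep3_tab p f : rep3 p f -> rep3 (tab3 p) f.
Proof. by move=> h i j k; rewrite tab3E. Qed.

Lemma rep3_mod ms p f : relations env ms -> rep3 p f ->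
  rep3 (fun i j k => preduce ms (p i j k)) f.
Proof. by move=> hm h i j k; rewrite pev_mod. Qed.

Lemma rep2_tab p f : rep2 p f -> rep2 (tab2 p) f.
Proof. by move=> h i j; rewrite tab2E. Qed.

Lemma rep2_mod ms p f : relations env ms -> rep2 p f ->
  rep2 (fun i j => preduce ms (p i j)) f.
Proof. by move=> hm h i j; rewrite pev_mod. Qed.

Lemma rep4_tab p f : rep4 p f -> rep4 (tab4 p) f.
Proof. by move=> h i j k l; rewrite tab4E. Qed.

Lemma pev1 : ev (pint 1) = 1. Proof. by rewrite pev_int. Qed.

Lemma pevN1 : ev (pint (-1)) = -1. Proof. by rewrite pev_int. Qed.

Lemma pev_index b : ev (pindex b) = b%:R.
Proof. by case: b; rewrite ?pev1. Qed.

Lemma pev_fracE d : ev (pfrac d) = (Pos.to_nat d)%:R^-1.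
Proof. by rewrite pev_frac. Qed.

Lemma rep_e2 a b : rep2 (pe2 a b) (e2 R a b).
Proof.
move=> i j; rewrite /e2 /pe2 mxE pevB !pev_index.
rewrite (expand_det_row _ ord0) !big_ord_recl big_ord0 /cofactor !det_mx11.
by rewrite !mxE /= -!mulnb !natrM; ring.
Qed.

Lemma rep_e3 a b c : rep3 (pe3 a b c) (e3 R a b c).
Proof.
move=> i j k; rewrite /e3 /pe3 pevB !pevD !pev_index.
rewrite (expand_det_row _ ord0) !big_ord_recl big_ord0 /cofactor.
rewrite !(expand_det_row _ ord0) !big_ord_recl !big_ord0 /cofactor !det_mx11.
by rewrite !mxE /= -!mulnb !natrM; ring.
Qed.

Lemma rep_omega : rep2 pomega (omega R).
Proof.
move=> i j; rewrite /omega /pomega 2!pevD -!rep_e2 mxE; congr (_ + _).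
by rewrite mxE.
Qed.

Lemma pev_levi (i j k l m n : 'I_6) :
  levi_civita R i j k l m n = ev (plevi i j k l m n).
Proof.
rewrite /levi_civita /plevi /=; case: ifP => // _.
rewrite -signr_odd; case: (odd _); first by rewrite pevN1.
by rewrite pev1.
Qed.

Lemma rep_K ph phi : rep3 ph phi -> rep2 (pK ph) (K_form phi).
Proof.
move=> h i v; rewrite /pK mxE pevN pevM pev_fracE; congr (- (_ * _)).
rewrite pev_sum; apply: eq_bigr => j _; rewrite pev_sum; apply: eq_bigr => k _.
rewrite pev_lmul pev_sum mulr_sumr; apply: eq_bigr => l _.
rewrite pev_sum mulr_sumr; apply: eq_bigr => m _.
rewrite pev_sum mulr_sumr; apply: eq_bigr => n _.
by rewrite pev_lmul -!h -pev_levi; ring.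
Qed.

Lemma rep_mulM p q (A B : 'M[R]_6) : rep2 p A -> rep2 q B ->
  rep2 (pmulmx p q) (A *m B).
Proof.
move=> hA hB i j; rewrite mxE pev_sum; apply: eq_bigr => k _.
by rewrite pev_lmul hA hB.
Qed.

Lemma rep_trace p (A : 'M[R]_6) : rep2 p A -> \tr A = ev (ptrace p).
Proof. by move=> h; rewrite pev_sum; apply: eq_bigr => i _; exact: h. Qed.

Lemma pdetP n (p : pmx) (A : 'M[R]_n) :
  (forall i j, A i j = ev (p i j)) -> \det A = ev (pdet n p).
Proof.
elim: n p A => [|n IH] p A h; first by rewrite det_mx00 pev1.
rewrite (expand_det_row _ ord0).
transitivity (\sum_(j < n.+1) ev (pmul (p 0%N j)
    (pmul (if odd j then pint (-1) else pint 1)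
       (pdet n (fun i k => p i.+1 (bump j k)))))).
  apply: eq_bigr => j _; rewrite !pevM h; congr (_ * _).
  rewrite /cofactor -signr_odd add0n; congr (_ * _).
    by case: (odd j); rewrite ?pevN1 ?pev1.
  apply: IH => i k; rewrite !mxE h; congr (ev (p _ _)).
rewrite -(big_mkord xpredT (fun j => ev (pmul (p 0%N j)
    (pmul (if odd j then pint (-1) else pint 1)
       (pdet n (fun i k => p i.+1 (bump j k))))))).
rewrite [pdet n.+1 p]/= -/(iota 0 n.+1) /index_iota subn0.
rewrite -[padd _ _]/(foldr (fun j r => padd (lmul (p 0%N j) (fun _ =>
        pmul (if odd j then pint (-1) else pint 1)
             (pdet n (fun i k => p i.+1 (bump j k))))) r) [::] (iota 0 n.+1)).
elim: (iota 0 n.+1) => [|j s IHs] /=; first by rewrite big_nil.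
by rewrite big_cons pevD pev_lmul IHs pevM.
Qed.

Lemma rep_raise gi (g : 'M[R]_6) ph phi : rep2 gi (invmx g) -> rep3 ph phi ->
  rep3 (praise gi ph) (raise3 g phi).
Proof.
move=> hg h i j k; rewrite /raise3 /praise pev_sum; apply: eq_bigr => a _.
rewrite pev_lmul pev_sum mulr_sumr; apply: eq_bigr => b _.
rewrite pev_lmul pev_sum !mulr_sumr; apply: eq_bigr => c _.
by rewrite pev_lmul -!hg -h !mulrA.
Qed.

Lemma rep_norm2 ph up phi : rep3 ph phi ->
  rep3 up (raise3 (g_form phi) phi) -> norm2_form phi = ev (pnorm2 ph up).
Proof.
move=> h hu; rewrite /norm2_form pevM pev_fracE; congr (_ * _).
rewrite pev_sum; apply: eq_bigr => i _; rewrite pev_sum; apply: eq_bigr => j _.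
by rewrite pev_sum; apply: eq_bigr => k _; rewrite pev_lmul h hu.
Qed.

Lemma rep_star up phi : rep3 up (raise3 (g_form phi) phi) ->
  \det (g_form phi) = 1 -> rep3 (pstar up) (star phi).
Proof.
move=> hu hd l m n; rewrite /star hd sqrtr1 mulr1 pevM pev_fracE; congr (_ * _).
rewrite pev_sum; apply: eq_bigr => i _; rewrite pev_sum; apply: eq_bigr => j _.
by rewrite pev_sum; apply: eq_bigr => k _; rewrite pev_lmul hu pev_levi mulrC.
Qed.

Lemma rep_d3 pdc dc ph phi : rep3 pdc dc -> rep3 ph phi ->
  rep4 (pd3 pdc ph) (linv_d3 dc phi).
Proof.
move=> hd h i j k l; rewrite pev_sum; apply: eq_bigr => m _.
by rewrite !(pevB, pevD, pev_lmul) -!hd -!h.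
Qed.

Lemma rep_d2 pdc dc p (b : 'M[R]_6) : rep3 pdc dc -> rep2 p b ->
  rep3 (pd2 pdc p) (linv_d2 dc b).
Proof.
move=> hd h i j k; rewrite pev_sum; apply: eq_bigr => l _.
by rewrite !(pevB, pevD, pev_lmul) -!hd -!h.
Qed.

Lemma mulmx_omega : omega R *m - omega R = 1%:M.
Proof.
apply/matrixP => i j; rewrite mulmxN mxE (rep_mulM rep_omega rep_omega) -pevN.
rewrite mxE -pev_index; apply: (@peq_modP _ _ [::]) => //.
suff : all6 (fun i => all6 (fun j => peq_mod [::]
         (popp (pmulmx pomega pomega i j)) (pindex (i == j)))).
  by move=> /all6P/(_ i) /all6P/(_ j).
by vm_compute.
Qed.

Lemma invmx_omega : invmx (omega R) = - omega R.
Proof.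
have [u _] := mulmx1_unit mulmx_omega.
by rewrite -[LHS]mulmx1 -mulmx_omega mulmxA mulVmx// mul1mx.
Qed.

Lemma rep_Lambda4 p al : rep4 p al -> rep2 (pLambda4 p) (Lambda4 al).
Proof.
move=> h k l; rewrite mxE pevM pev_fracE; congr (_ * _).
rewrite pev_sum; apply: eq_bigr => i _; rewrite pev_sum; apply: eq_bigr => j _.
by rewrite invmx_omega mxE pev_lmul pevN -rep_omega h.
Qed.

Lemma rep_Lambda3 p phi (k : 'I_6) : rep3 p phi ->
  Lambda3 phi k = ev (pLambda3 p k).
Proof.
move=> h; rewrite /Lambda3 pevM pev_fracE; congr (_ * _).
rewrite pev_sum; apply: eq_bigr => i _; rewrite pev_sum; apply: eq_bigr => j _.
by rewrite invmx_omega mxE pev_lmul pevN -rep_omega h.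
Qed.

Lemma rep_nij pdc dc pJ (J : 'M[R]_6) : rep3 pdc dc -> rep2 pJ J ->
  rep3 (pnij pdc pJ) (linv_nijenhuis dc J).
Proof.
move=> hd h i j k; rewrite /pnij pevM pev_fracE 3!pevD pevN -hd.
congr (_ * (- _ + _ + _ + _)); rewrite pev_sum; apply: eq_bigr => a _;
  rewrite pev_sum; apply: eq_bigr => b _;
  by rewrite !pev_lmul -!h -hd mulrA.
Qed.

Lemma rep_nijnorm pg pgi pN (g gi : 'I_6 -> 'I_6 -> R) N :
  rep2 pg g -> rep2 pgi gi -> rep3 pN N ->
  \sum_i \sum_j \sum_k \sum_a \sum_b \sum_c
    g i a * gi j b * gi k c * N i j k * N a b c = ev (pnijnorm2 pg pgi pN).
Proof.
move=> hg hgi hN.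
rewrite pev_sum; apply: eq_bigr => i _; rewrite pev_sum; apply: eq_bigr => j _.
rewrite pev_sum; apply: eq_bigr => k _; rewrite pev_lmul pev_sum mulr_sumr.
apply: eq_bigr => a _; rewrite pev_lmul pev_sum !mulr_sumr.
apply: eq_bigr => b _; rewrite pev_lmul pev_sum !mulr_sumr.
apply: eq_bigr => c _; rewrite pev_lmul -!hg -!hgi -!hN; ring.
Qed.

Lemma rep_christoffel pdc dc pg pgi (g : 'M[R]_6) :
  rep3 pdc dc -> rep2 pg g -> rep2 pgi (invmx g) ->
  rep3 (pchristoffel pdc pg pgi) (linv_christoffel dc g).
Proof.
move=> hd hg hgi i j l; rewrite /pchristoffel /linv_christoffel pevM pev_fracE.
congr (_ * _); rewrite pev_sum; apply: eq_bigr => k _.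
rewrite pev_lmul -hgi; congr (_ * _); rewrite !pevB !pevN !pev_sum.
by congr (- _ - - _ - - _); apply: eq_bigr => m _; rewrite pev_lmul -hd -hg.
Qed.

Lemma rep_ricci pdc dc pC (g : 'M[R]_6) :
  rep3 pdc dc -> rep3 pC (linv_christoffel dc g) ->
  rep2 (pricci pdc pC) (linv_ricci dc g).
Proof.
move=> hd hC j k; rewrite pev_sum; apply: eq_bigr => i _.
rewrite pev_sum; apply: eq_bigr => l _.
by rewrite pevD pevB !pev_lmul -!hC -hd.
Qed.

End Soundness.

(** * Geometry of a positive 3-form by computation *)

(** The polynomials [ps] and [pis] stand for s = sqrt (- lambda) and for 1 / s.
    With their help J = K / s and g = omega J have polynomial components, and so
    has the inverse of g, which is J omega because J^2 = -1. *)
Section Geometry.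
Variables (ms : seq mono) (ph : pform3) (ps pis : pol).

Definition geoK : pmx := tab2 (fun i j => preduce ms (pK ph i j)).
Definition geoJ : pmx :=
  let K := geoK in tab2 (fun i j => preduce ms (pmul pis (K i j))).
Definition geog : pmx :=
  let J := geoJ in tab2 (fun i j => preduce ms (pmulmx pomega J i j)).
Definition geogi : pmx :=
  let J := geoJ in tab2 (fun i j => preduce ms (pmulmx J pomega i j)).
Definition geoup : pform3 :=
  let gi := geogi in tab3 (fun i j k => preduce ms (praise gi ph i j k)).
Definition geoflux : pform3 :=
  let up := geoup in let n2 := preduce ms (pnorm2 ph up) in
  tab3 (fun i j k => preduce ms (pmul n2 (pstar up i j k))).
Definition geoflow (dc : pform3) : pform3 :=
  let F := geoflux in let a := tab4 (pd3 dc F) in let b := tab2 (pLambda4 a) in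
  tab3 (fun i j k => preduce ms (pd2 dc b i j k)).
Definition geonij (dc : pform3) : pform3 :=
  let J := geoJ in tab3 (fun i j k => preduce ms (pnij dc J i j k)).
Definition geonijnorm2 (dc : pform3) : pol :=
  let g := geog in let gi := geogi in let N := geonij dc in
  preduce ms (pnijnorm2 g gi N).
Definition geochris (dc : pform3) : pform3 :=
  let g := geog in let gi := geogi in
  tab3 (fun i j k => preduce ms (pchristoffel dc g gi i j k)).
Definition georicci (dc : pform3) : pmx :=
  let C := geochris dc in tab2 (fun i j => preduce ms (pricci dc C i j)).

Definition geo_ok : bool :=
  let K := geoK in let g := geog in let gi := geogi in
  [&& peq_mod ms (pmul (pfrac 6) (ptrace (pmulmx K K))) (popp (pmul ps ps)),
      peq_mod ms (pmul pis ps) (pint 1),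
      all6 (fun i => all6 (fun j =>
        peq_mod ms (pmulmx g gi i j) (pindex (i == j)))),
      peq_mod ms (pdet 6 g) (pint 1),
      all6 (fun i => all6 (fun j => peq_mod ms (g i j) (g j i))) &
      all6 (fun k => peq_mod ms (pLambda3 ph k) [::])].

Variables (R : realType) (env : seq R) (phi : form3 R).
Hypotheses (hm : relations env ms) (hphi : rep3 env ph phi).
Hypotheses (hs : 0 < pev env ps) (ok : geo_ok).

Lemma geoK_rep : rep2 env geoK (K_form phi).
Proof. by apply: rep2_tab; apply: rep2_mod => //; exact: rep_K. Qed.

Lemma geo_lambda : lambda_form phi = - pev env ps ^+ 2.
Proof.
move: ok => /andP[/(peq_modP hm) + /and5P[_ _ _ _ _]].
rewrite pevM pev_fracE pevN pevM -expr2 => <-.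
by rewrite /lambda_form (rep_trace (rep_mulM geoK_rep geoK_rep)).
Qed.

Lemma geoJ_rep : rep2 env geoJ (J_form phi).
Proof.
apply: rep2_tab; apply: rep2_mod => // i j.
rewrite pevM -geoK_rep mxE geo_lambda opprK sqrtr_sqr gtr0_norm//.
congr (_ * _); move: ok => /andP[_ /and5P[/(peq_modP hm) + _ _ _ _]].
rewrite pevM pev1 => h; apply: (mulIf (lt0r_neq0 hs)).
by rewrite h mulVf// lt0r_neq0.
Qed.

Lemma geog_rep : rep2 env geog (g_form phi).
Proof.
apply: rep2_tab; apply: rep2_mod => //; apply: rep_mulM; first exact: rep_omega.
exact: geoJ_rep.
Qed.

(** Checked entrywise on the polynomials, rather than deduced from J^2 = -1. *)
Lemma geo_inverse : g_form phi *m (J_form phi *m omega R) = 1%:M.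
Proof.
have h : rep2 env geogi (J_form phi *m omega R).
  by apply: rep2_tab; apply: rep2_mod => //; apply: rep_mulM;
    [exact: geoJ_rep | exact: rep_omega].
apply/matrixP => i j; rewrite (rep_mulM geog_rep h) mxE -(pev_index env).
move: ok => /andP[_ /and5P[_ /all6P/(_ i)/all6P/(_ j) /(peq_modP hm) -> _ _ _]].
by [].
Qed.

Lemma geogi_rep : rep2 env geogi (invmx (g_form phi)).
Proof.
have [u _] := mulmx1_unit geo_inverse.
have -> : invmx (g_form phi) = J_form phi *m omega R.
  by rewrite -[LHS]mulmx1 -geo_inverse (mulmxA (invmx _)) mulVmx// mul1mx.
by apply: rep2_tab; apply: rep2_mod => //; apply: rep_mulM;
    [exact: geoJ_rep | exact: rep_omega].
Qed.

Lemma geo_det : \det (g_form phi) = 1.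
Proof.
rewrite (pdetP geog_rep).
by move: ok => /andP[_ /and5P[_ _ /(peq_modP hm) -> _ _]]; rewrite pev1.
Qed.

Lemma geo_sym : (g_form phi)^T = g_form phi.
Proof.
apply/matrixP => i j; rewrite mxE !geog_rep.
by move: ok => /andP[_ /and5P[_ _ _ /all6P/(_ j)/all6P/(_ i) /(peq_modP hm) -> _]].
Qed.

Lemma geo_primitive : primitive phi.
Proof.
move=> k; rewrite (rep_Lambda3 _ hphi).
by move: ok => /andP[_ /and5P[_ _ _ _ /all6P/(_ k) /(peq_modP hm) ->]].
Qed.

Lemma geo_positive : (forall v : 'rV[R]_6, v != 0 ->
  0 < (v *m g_form phi *m v^T) 0 0) -> positive phi.
Proof.
move=> h; split; [exact: geo_primitive| |split=> //; exact: geo_sym].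
by rewrite geo_lambda oppr_lt0 exprn_gt0.
Qed.

Lemma geoup_rep : rep3 env geoup (raise3 (g_form phi) phi).
Proof.
apply: rep3_tab; apply: rep3_mod => //; apply: rep_raise => //.
exact: geogi_rep.
Qed.

Lemma geoflux_rep :
  rep3 env geoflux (fun i j k => norm2_form phi * star phi i j k).
Proof.
apply: rep3_tab; apply: rep3_mod => // i j k.
rewrite pevM pev_mod// -(rep_norm2 hphi geoup_rep).
by rewrite (rep_star geoup_rep geo_det).
Qed.

Variables (pdc : pform3) (dc : 'I_6 -> 'I_6 -> 'I_6 -> R).
Hypothesis hdc : rep3 env pdc dc.

Lemma geoflow_rep : rep3 env (geoflow pdc) (linv_flow dc phi).
Proof.
apply: rep3_tab; apply: rep3_mod => //; apply: rep_d2 => //.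
apply: rep2_tab; apply: rep_Lambda4; apply: rep4_tab; apply: rep_d3 => //.
exact: geoflux_rep.
Qed.

Lemma geonij_rep : rep3 env (geonij pdc) (linv_nijenhuis dc (J_form phi)).
Proof.
apply: rep3_tab; apply: rep3_mod => //; apply: rep_nij => //.
exact: geoJ_rep.
Qed.

Lemma geonijnorm2P :
  let N := linv_nijenhuis dc (J_form phi) in
  \sum_i \sum_j \sum_k \sum_a \sum_b \sum_c
    g_form phi i a * invmx (g_form phi) j b * invmx (g_form phi) k c
    * N i j k * N a b c = pev env (geonijnorm2 pdc).
Proof.
move=> N; rewrite pev_mod//.
exact: (rep_nijnorm geog_rep geogi_rep geonij_rep).
Qed.

Lemma georicci_rep : rep2 env (georicci pdc) (linv_ricci dc (g_form phi)).
Proof.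
apply: rep2_tab; apply: rep2_mod => //; apply: rep_ricci => //.
apply: rep3_tab; apply: rep3_mod => //; apply: rep_christoffel => //.
  exact: geog_rep.
exact: geogi_rep.
Qed.

End Geometry.

Definition pnil_form (u b : pol) : pform3 := fun i j k =>
  padd (psub (psub (psub (pmul u (pe3 1 3 5 i j k)) (pe3 1 4 6 i j k))
    (pe3 2 4 5 i j k)) (pe3 2 3 6 i j k))
  (pmul b (psub (pe3 1 3 4 i j k) (pe3 1 5 6 i j k))).

Definition pnil_structure : pform3 := fun k i j =>
  if k == 3%N then pe2 1 5 i j else if k == 5%N then pe2 1 3 i j else [::].

Definition psol_form (al be ga de : pol) : pform3 := fun i j k =>
  psub (padd (padd (pmul al (padd (pe3 1 3 5 i j k) (pe3 1 3 6 i j k)))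
    (pmul be (psub (pe3 1 4 5 i j k) (pe3 1 4 6 i j k))))
    (pmul ga (psub (pe3 2 3 5 i j k) (pe3 2 3 6 i j k))))
    (pmul de (padd (pe3 2 4 5 i j k) (pe3 2 4 6 i j k))).

Definition psol_structure (l : pol) : pform3 := fun k i j =>
  if k == 0%N then popp (pmul l (pe2 1 5 i j)) else
  if k == 1%N then pmul l (pe2 2 5 i j) else
  if k == 2%N then popp (pmul l (pe2 3 6 i j)) else
  if k == 3%N then pmul l (pe2 4 6 i j) else [::].

(** * Pointwise checks *)

Definition alt_ok (ph : pform3) : bool :=
  all6 (fun i => all6 (fun j => all6 (fun k =>
    peq_mod [::] (ph j i k) (popp (ph i j k))
    && peq_mod [::] (ph i k j) (popp (ph i j k))))).

Definition closed_ok (dc ph : pform3) : bool :=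
  all6 (fun i => all6 (fun j => all6 (fun k => all6 (fun l =>
    peq_mod [::] (pd3 dc ph i j k l) [::])))).

(** The quadratic form of [g] at the vector whose components are the variables
    from index [n] on. *)
Definition pquad (n : nat) (g : pmx) : pol :=
  psum (fun i => psum (fun j =>
    lmul (pvar (n + i)) (fun _ => lmul (g i j) (fun _ => pvar (n + j))))).

Section Checks.
Variables (R : realType) (env : seq R).

Lemma relations0 : relations env [::]. Proof. by []. Qed.

Lemma alt_okP ph phi : rep3 env ph phi -> alt_ok ph -> alternating phi.
Proof.
move=> h ok i j k.
have /all6P/(_ j)/all6P/(_ k)/andP[] := all6P ok i.
move=> /(peq_modP relations0) h1 /(peq_modP relations0) h2.
by rewrite !h h1 h2 pevN.
Qed.

Lemma closed_okP pdc dc ph phi : rep3 env pdc dc -> rep3 env ph phi ->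
  closed_ok pdc ph -> forall i j k l, linv_d3 dc phi i j k l = 0.
Proof.
move=> hd h ok i j k l; rewrite (rep_d3 hd h).
have /all6P/(_ j)/all6P/(_ k)/all6P/(_ l) := all6P ok i.
by move=> /(peq_modP relations0) ->.
Qed.

Lemma rep_quad n p (A : 'M[R]_6) (v : 'rV[R]_6) :
  (forall i : 'I_6, pev env (pvar (n + i)) = v 0 i) -> rep2 env p A ->
  (v *m A *m v^T) 0 0 = pev env (pquad n p).
Proof.
move=> hv h; rewrite pev_sum -mulmxA mxE; apply: eq_bigr => i _.
rewrite pev_sum mxE mulr_sumr; apply: eq_bigr => j _.
by rewrite !pev_lmul -!h !hv mxE.
Qed.

Lemma pev_var_cat (s : seq R) (v : 'rV[R]_6) (i : 'I_6) :
  env = s ++ [seq v 0 i | i <- enum 'I_6] ->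
  pev env (pvar (size s + i)) = v 0 i.
Proof.
move=> ->; rewrite pev_var; last by rewrite size_cat ltn_add2l size_map size_enum_ord.
rewrite nth_cat ltnNge leq_addr /= addKn (nth_map 0) ?size_enum_ord//.
by rewrite nth_ord_enum.
Qed.

End Checks.

(** * The nilmanifold: pointwise computations *)

Section Nil.
Variable R : realType.
Implicit Types (a b : R) (v : 'rV[R]_6).

Lemma rep_nil_form (env : seq R) pu pb a b :
  pev env pu = 1 + a -> pev env pb = b ->
  rep3 env (tab3 (pnil_form pu pb)) (nil_form a b).
Proof.
move=> hu hb; apply: rep3_tab => i j k.
rewrite /nil_form /pnil_form pevD pevB pevB pevB pevM pevM pevB hu hb.
by rewrite -!rep_e3.
Qed.

Lemma nil_lambda a b : lambda_form (nil_form a b) = - (4%:R * (1 + a - b ^+ 2)).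
Proof.
have hr : rep3 [:: 1 + a; b] (tab3 (pnil_form (pvar 0) (pvar 1))) (nil_form a b).
  by apply: rep_nil_form; rewrite pev_var.
have hK := rep2_tab (rep_K hr).
rewrite /lambda_form (rep_trace (rep_mulM hK hK)).
set t := pev _ _.
transitivity (pev [:: 1 + a; b] (popp (pmul (pint 4)
   (psub (pvar 0) (pmul (pvar 1) (pvar 1)))))); last first.
  by rewrite pevN pevM pevB pevM pev_int !pev_var.
transitivity (pev [:: 1 + a; b] (pmul (pfrac 6) (ptrace
   (pmulmx (tab2 (pK (tab3 (pnil_form (pvar 0) (pvar 1)))))
           (tab2 (pK (tab3 (pnil_form (pvar 0) (pvar 1))))))))).
  by rewrite pevM pev_fracE.
by apply: (@peq_modP _ _ [::]) => //; vm_compute.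
Qed.

(** The variables are q, 1 / q and b, where q = sqrt (1 + a - b^2); hence
    1 + a = q^2 + b^2. *)
Definition nil_pu : pol := padd (pmul (pvar 0) (pvar 0)) (pmul (pvar 2) (pvar 2)).
Definition nil_ph : pform3 := tab3 (pnil_form nil_pu (pvar 2)).
Definition nil_ms : seq mono := [:: [:: 1; 1]]%N.
Definition nil_ps : pol := pmul (pint 2) (pvar 0).
Definition nil_pis : pol := pmul (pfrac 2) (pvar 1).

Lemma nil_geo_ok : geo_ok nil_ms nil_ph nil_ps nil_pis.
Proof. by vm_compute. Qed.

Variables (a b : R).
Hypothesis hab : b ^+ 2 < 1 + a.
Let q := Num.sqrt (1 + a - b ^+ 2).

Let q_gt0 : 0 < q. Proof. by rewrite sqrtr_gt0 subr_gt0. Qed.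

Let q2 : q ^+ 2 = 1 + a - b ^+ 2.
Proof. by rewrite sqr_sqrtr// subr_ge0 ltW. Qed.

Definition nil_env (s : seq R) : seq R := [:: q, q^-1, b & s].

Lemma nil_relations s : relations (nil_env s) nil_ms.
Proof.
move=> n; rewrite inE => /eqP -> /=.
by rewrite !expr1 mulr1 mulfV// gt_eqF.
Qed.

Lemma nil_rep s : rep3 (nil_env s) nil_ph (nil_form a b).
Proof.
apply: rep_nil_form; last by rewrite pev_var.
by rewrite pevD !pevM !pev_var// -!expr2 q2 subrK.
Qed.

Lemma nil_ps_gt0 s : 0 < pev (nil_env s) nil_ps.
Proof. by rewrite pevM pev_int pev_var// mulr_gt0. Qed.

Lemma nil_alternating : alternating (nil_form a b).
Proof. by apply: (alt_okP (nil_rep [::])); vm_compute. Qed.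

(** Completing squares, as q^2 = 1 + a - b^2. *)
Lemma nil_quad v : let x k := v 0 (inord k) in
  (v *m g_form (nil_form a b) *m v^T) 0 0 =
  q^-1 * ((q * x 0%N) ^+ 2 + x 1%N ^+ 2 + (b * x 2%N + x 5%N) ^+ 2
    + (q * x 2%N) ^+ 2 + (b * x 4%N + x 3%N) ^+ 2 + (q * x 4%N) ^+ 2).
Proof.
move=> x; set s := [seq v 0 i | i <- enum 'I_6].
have hv (i : 'I_6) : pev (nil_env s) (pvar (3 + i)) = v 0 i.
  exact: (@pev_var_cat _ _ [:: q; q^-1; b]).
have hg := geog_rep (@nil_relations s) (@nil_rep s) (@nil_ps_gt0 s) nil_geo_ok.
rewrite (rep_quad hv hg).
have xE i : (i < 6)%N -> x i = pev (nil_env s) (pvar (3 + i)).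
  by move=> i6; rewrite -{2}(inordK i6) hv.
have E0 : q = pev (nil_env s) (pvar 0) by rewrite pev_var.
have E1 : q^-1 = pev (nil_env s) (pvar 1) by rewrite pev_var.
have E2 : b = pev (nil_env s) (pvar 2) by rewrite pev_var.
pose sq p := pmul p p; pose y i := pvar (3 + i).
transitivity (pev (nil_env s) (pmul (pvar 1) (padd (padd (padd (padd (padd
  (sq (pmul (pvar 0) (y 0%N))) (sq (y 1%N)))
  (sq (padd (pmul (pvar 2) (y 2%N)) (y 5%N)))) (sq (pmul (pvar 0) (y 2%N))))
  (sq (padd (pmul (pvar 2) (y 4%N)) (y 3%N)))) (sq (pmul (pvar 0) (y 4%N)))))).
  by apply: (peq_modP (@nil_relations s)); vm_compute.
by rewrite {}/sq {}/y pevM 5!pevD !pevM 2!pevD !pevM -E0 -E1 -E2 -!xE.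
Qed.

Lemma row6_eq0 v : (forall k, (k < 6)%N -> v 0 (inord k) = 0) -> v = 0.
Proof.
move=> h; apply/rowP => i; rewrite mxE -(h i (ltn_ord i)).
by congr (v 0 _); apply/val_inj; rewrite /= inordK.
Qed.

Lemma nil_positive : positive (nil_form a b).
Proof.
apply: (geo_positive (@nil_relations [::]) (@nil_rep _) (@nil_ps_gt0 _) nil_geo_ok).
move=> v v0; rewrite nil_quad mulr_gt0 ?invr_gt0//.
rewrite lt_neqAle eq_sym !addr_ge0 ?sqr_ge0// andbT.
apply: contraNN v0 => /eqP h.
have sq0 (y : R) : y ^+ 2 <= 0 -> y = 0.
  by move=> y0; apply/eqP; rewrite -sqrf_eq0 eq_le y0 sqr_ge0.
have mq (y : R) : (q * y) ^+ 2 <= 0 -> y = 0.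
  by move=> /sq0 /eqP; rewrite mulf_eq0 gt_eqF//= => /eqP.
move: h; set x0 := v 0 (inord 0); set x1 := v 0 (inord 1).
set x2 := v 0 (inord 2); set x3 := v 0 (inord 3).
set x4 := v 0 (inord 4); set x5 := v 0 (inord 5) => h.
have := sqr_ge0 (q * x0); have := sqr_ge0 x1; have := sqr_ge0 (b * x2 + x5).
have := sqr_ge0 (q * x2); have := sqr_ge0 (b * x4 + x3).
have := sqr_ge0 (q * x4) => g1 g2 g3 g4 g5 g6.
have X0 : x0 = 0 by apply: mq; lra.
have X1 : x1 = 0 by apply: sq0; lra.
have X2 : x2 = 0 by apply: mq; lra.
have X4 : x4 = 0 by apply: mq; lra.
have X5 : x5 = 0 by apply: sq0; move: g4 h; rewrite X2 mulr0 add0r; lra.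
have X3 : x3 = 0 by apply: sq0; move: g2 h; rewrite X4 mulr0 add0r; lra.
apply/eqP/row6_eq0 => -[|[|[|[|[|[|//]]]]]] _;
  [exact: X0|exact: X1|exact: X2|exact: X3|exact: X4|exact: X5].
Qed.

Definition nil_dc : 'I_6 -> 'I_6 -> 'I_6 -> R :=
  fun k i j => nth 0 (nil_structure R) k i j.

Lemma rep_nil_dc (env : seq R) : rep3 env pnil_structure nil_dc.
Proof.
move=> k i j; rewrite /nil_dc /nil_structure /pnil_structure.
by case: k => -[|[|[|[|[|[|//]]]]]] /= _; first [exact: mxE | exact: rep_e2].
Qed.

Lemma nil_closed i j k l : linv_d3 nil_dc (nil_form a b) i j k l = 0.
Proof. by apply: (closed_okP (rep_nil_dc _) (nil_rep [::])); vm_compute. Qed.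

(** The part of d (|phi|^2 star phi) along e^{1235} contracts to a multiple of the
    closed form e^{35}.  The rest of it comes from the component of
    |phi|^2 star phi along e^{246}, which is the constant -4. *)
Lemma nil_flow i j k :
  linv_flow nil_dc (nil_form a b) i j k = 8%:R * e3 R 1 3 5 i j k.
Proof.
have hr := geoflow_rep (@nil_relations [::]) (@nil_rep _) (@nil_ps_gt0 _)
             nil_geo_ok (rep_nil_dc _).
rewrite hr.
transitivity (pev (nil_env [::]) (pmul (pint 8) (pe3 1 3 5 i j k))); last first.
  by rewrite pevM pev_int -rep_e3.
apply: (peq_modP (@nil_relations [::])).
suff : let F := geoflow nil_ms nil_ph nil_pis pnil_structure in
    all6 (fun i => all6 (fun j => all6 (fun k => peq_mod nil_ms (F i j k)
     (pmul (pint 8) (pe3 1 3 5 i j k))))).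
  by move=> /all6P/(_ i)/all6P/(_ j)/all6P/(_ k).
by vm_compute.
Qed.

Lemma nil_nijenhuis_norm2 :
  let phi := nil_form a b in let N := linv_nijenhuis nil_dc (J_form phi) in
  \sum_i \sum_j \sum_k \sum_a \sum_b \sum_c
    g_form phi i a * invmx (g_form phi) j b * invmx (g_form phi) k c
    * N i j k * N a b c = q^-1 ^+ 3.
Proof.
rewrite /= (geonijnorm2P (@nil_relations [::]) (@nil_rep _) (@nil_ps_gt0 _)
             nil_geo_ok (rep_nil_dc _)).
transitivity (pev (nil_env [::]) (pmul (pvar 1) (pmul (pvar 1) (pvar 1)))).
  by apply: (peq_modP (@nil_relations [::])); vm_compute.
by rewrite !pevM pev_var.
Qed.

End Nil.

(** * The solvmanifold: pointwise computations *)

Section Sol.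
Variable R : realType.
Implicit Types (A B C D : R) (v : 'rV[R]_6).

Lemma rep_sol_form (env : seq R) pa pb pc pd A B C D :
  pev env pa = A -> pev env pb = B -> pev env pc = C -> pev env pd = D ->
  rep3 env (tab3 (psol_form pa pb pc pd)) (sol_form A B C D).
Proof.
move=> hA hB hC hD; apply: rep3_tab => i j k.
rewrite /sol_form /psol_form pevB 2!pevD !pevM 2!pevD 2!pevB hA hB hC hD.
by rewrite -!rep_e3.
Qed.

Definition sol_ph : pform3 :=
  tab3 (psol_form (pvar 0) (pvar 1) (pvar 2) (pvar 3)).
(** The fifth variable is r = 1 / sqrt (A B C D), so that A B C D r^2 = 1. *)
Definition sol_ms : seq mono := [:: [:: 1; 1; 1; 1; 2]]%N.
Definition sol_pabcd : pol :=
  pmul (pmul (pmul (pvar 0) (pvar 1)) (pvar 2)) (pvar 3).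
Definition sol_ps : pol := pmul (pint 4) (pmul sol_pabcd (pvar 4)).
Definition sol_pis : pol := pmul (pfrac 4) (pvar 4).

Definition sol_env A B C D (s : seq R) : seq R :=
  [:: A, B, C, D, (Num.sqrt (A * B * C * D))^-1, sol_constant R & s].

Lemma sol_rep A B C D s : rep3 (sol_env A B C D s) sol_ph (sol_form A B C D).
Proof. by apply: rep_sol_form; rewrite pev_var. Qed.

Lemma sol_lambda A B C D :
  lambda_form (sol_form A B C D) = - (16%:R * (A * B * C * D)).
Proof.
have hK := rep2_tab (rep_K (sol_rep A B C D [::])).
rewrite /lambda_form (rep_trace (rep_mulM hK hK)).
transitivity (pev (sol_env A B C D [::]) (popp (pmul (pint 16) sol_pabcd))); last first.
  by rewrite pevN 4!pevM pev_int !pev_var.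
transitivity (pev (sol_env A B C D [::]) (pmul (pfrac 6) (ptrace
   (pmulmx (tab2 (pK sol_ph)) (tab2 (pK sol_ph)))))).
  by rewrite pevM pev_fracE.
by apply: (@peq_modP _ _ [::]) => //; vm_compute.
Qed.

Lemma sol_omegaK A B C D : let M := omega R *m K_form (sol_form A B C D) in
  M (inord 0) (inord 0) = 4%:R * (A * B) /\ M (inord 2) (inord 2) = 4%:R * (A * C).
Proof.
have hK := rep2_tab (rep_K (sol_rep A B C D [::])).
have hM := rep_mulM (rep_omega _) hK.
have E i j : pev (sol_env A B C D [::]) (pmul (pint 4) (pmul (pvar i) (pvar j))) =
  4%:R * (pev (sol_env A B C D [::]) (pvar i) * pev (sol_env A B C D [::]) (pvar j)).
  by rewrite !pevM pev_int.
split.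
  transitivity (pev (sol_env A B C D [::]) (pmul (pint 4) (pmul (pvar 0) (pvar 1)))); last first.
    by rewrite E !pev_var.
  by rewrite hM !inordK//; apply: (@peq_modP _ _ [::]) => //; vm_compute.
transitivity (pev (sol_env A B C D [::]) (pmul (pint 4) (pmul (pvar 0) (pvar 2)))); last first.
  by rewrite E !pev_var.
by rewrite hM !inordK//; apply: (@peq_modP _ _ [::]) => //; vm_compute.
Qed.

Definition same_sign A B C D : Prop := [/\ 0 < A * B, 0 < A * C & 0 < A * D].

Lemma posdef_diag (g : 'M[R]_6) (i : 'I_6) : posdef g -> 0 < g i i.
Proof.
move=> [_ /(_ (delta_mx 0 i))]; rewrite trmx_delta -rowE -colE !mxE; apply.
by apply/eqP => /matrixP/(_ 0 i)/eqP; rewrite !mxE !eqxx oner_eq0.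
Qed.

(** The metric coefficients g_{11} and g_{33} are positive multiples of A B and
    A C, and lambda is a negative multiple of A B C D. *)
Lemma positive_same_sign A B C D :
  positive (sol_form A B C D) -> same_sign A B C D.
Proof.
move=> [_ l0 pd]; have [h0 h2] := sol_omegaK A B C D.
have r0 : 0 < (Num.sqrt (- lambda_form (sol_form A B C D)))^-1.
  by rewrite invr_gt0 sqrtr_gt0 oppr_gt0.
have E i : g_form (sol_form A B C D) i i =
   (Num.sqrt (- lambda_form (sol_form A B C D)))^-1 *
   (omega R *m K_form (sol_form A B C D)) i i.
  by rewrite /g_form /metric_of /J_form -scalemxAr mxE.
have /(@posdef_diag _ (inord 0)) := pd; have /(@posdef_diag _ (inord 2)) := pd.
rewrite !E h0 h2 (pmulr_rgt0 _ r0) (pmulr_rgt0 _ r0) !(pmulr_rgt0 _ (ltr0n R 4))/=.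
move=> AC AB; split => //.
move: l0; rewrite sol_lambda oppr_lt0 (pmulr_rgt0 _ (ltr0n R 16)) => P.
have A_neq0 : A != 0 by apply: contraTneq AB => ->; rewrite mul0r ltxx.
have : 0 < (A * B) * (A * C) * (A * D).
  rewrite (_ : _ * _ = A ^+ 2 * (A * B * C * D)); last by ring.
  by rewrite mulr_gt0// exprn_even_gt0.
by rewrite pmulr_rgt0// mulr_gt0.
Qed.

Lemma sol_geo_ok : geo_ok sol_ms sol_ph sol_ps sol_pis.
Proof. by vm_compute. Qed.

Variables (A B C D : R).
Hypothesis h : same_sign A B C D.

Let A_neq0 : A != 0.
Proof. by case: h => AB _ _; apply: contraTneq AB => ->; rewrite mul0r ltxx. Qed.

Let pos2 x y : 0 < A * x -> 0 < A * y -> 0 < x * y.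
Proof.
move=> hx hy; have : 0 < (A * x) * (A * y) by rewrite mulr_gt0.
rewrite (_ : _ * _ = A ^+ 2 * (x * y)); last by ring.
by rewrite pmulr_rgt0// exprn_even_gt0.
Qed.

Lemma same_sign_prod : 0 < A * B * C * D.
Proof. by case: h => AB AC AD; rewrite -mulrA mulr_gt0// pos2. Qed.

Let r : R := (Num.sqrt (A * B * C * D))^-1.

Let r_gt0 : 0 < r. Proof. by rewrite invr_gt0 sqrtr_gt0 same_sign_prod. Qed.

Lemma sol_relations s : relations (sol_env A B C D s) sol_ms.
Proof.
move=> n; rewrite inE => /eqP -> /=.
rewrite !expr1 mulr1 exprVn sqr_sqrtr ?ltW ?same_sign_prod// !mulrA.
by rewrite mulfV// gt_eqF// same_sign_prod.
Qed.

Lemma sol_ps_gt0 s : 0 < pev (sol_env A B C D s) sol_ps.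
Proof.
rewrite 5!pevM pev_int !pev_var//; apply: mulr_gt0 => //; apply: mulr_gt0 => //.
exact: same_sign_prod.
Qed.

Lemma sol_J_rep s :
  rep2 (sol_env A B C D s) (geoJ sol_ms sol_ph sol_pis) (J_form (sol_form A B C D)).
Proof.
exact: (geoJ_rep (@sol_relations s) (@sol_rep _ _ _ _ s) (@sol_ps_gt0 s) sol_geo_ok).
Qed.

Lemma sol_alternating : alternating (sol_form A B C D).
Proof. by apply: (alt_okP (sol_rep _ _ _ _ [::])); vm_compute. Qed.

Lemma sol_quad v : let x k := v 0 (inord k) in
  (v *m g_form (sol_form A B C D) *m v^T) 0 0 =
  r * (A * B * x 0%N ^+ 2 + C * D * x 1%N ^+ 2 + A * C * x 2%N ^+ 2
    + B * D * x 3%N ^+ 2 + A * D * (2%:R^-1 * (x 4%N + x 5%N) ^+ 2)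
    + B * C * (2%:R^-1 * (x 4%N - x 5%N) ^+ 2)).
Proof.
move=> x; set s := [seq v 0 i | i <- enum 'I_6].
have hv (i : 'I_6) : pev (sol_env A B C D s) (pvar (6 + i)) = v 0 i.
  exact: (@pev_var_cat _ _ [:: A; B; C; D; r; sol_constant R]).
have hg := geog_rep (@sol_relations s) (@sol_rep _ _ _ _ s) (@sol_ps_gt0 s) sol_geo_ok.
rewrite (rep_quad hv hg).
have xE i : (i < 6)%N -> x i = pev (sol_env A B C D s) (pvar (6 + i)).
  by move=> i6; rewrite -{2}(inordK i6) hv.
have EA : A = pev (sol_env A B C D s) (pvar 0) by rewrite pev_var.
have EB : B = pev (sol_env A B C D s) (pvar 1) by rewrite pev_var.
have EC : C = pev (sol_env A B C D s) (pvar 2) by rewrite pev_var.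
have ED : D = pev (sol_env A B C D s) (pvar 3) by rewrite pev_var.
have Er : r = pev (sol_env A B C D s) (pvar 4) by rewrite pev_var.
pose sq p := pmul p p; pose y i := pvar (6 + i).
pose t i j p := pmul (pmul (pvar i) (pvar j)) p.
transitivity (pev (sol_env A B C D s) (pmul (pvar 4) (padd (padd (padd (padd (padd
  (t 0%N 1%N (sq (y 0%N))) (t 2%N 3%N (sq (y 1%N)))) (t 0%N 2%N (sq (y 2%N))))
  (t 1%N 3%N (sq (y 3%N))))
  (t 0%N 3%N (pmul (pfrac 2) (sq (padd (y 4%N) (y 5%N))))))
  (t 1%N 2%N (pmul (pfrac 2) (sq (psub (y 4%N) (y 5%N)))))))).
  by apply: (peq_modP (@sol_relations s)); vm_compute.
rewrite {}/t {}/sq {}/y pevM 5!pevD !pevM pevB pevD !pev_fracE.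
by rewrite -EA -EB -EC -ED -Er -!xE.
Qed.

Lemma sol_positive : positive (sol_form A B C D).
Proof.
case: h => AB AC AD; have CD := pos2 AC AD; have BD := pos2 AB AD.
have BC := pos2 AB AC.
apply: (geo_positive (@sol_relations [::]) (@sol_rep _ _ _ _ _) (@sol_ps_gt0 _) sol_geo_ok).
move=> v v0; rewrite sol_quad mulr_gt0//.
have nn (a x : R) : 0 < a -> 0 <= a * x ^+ 2.
  by move=> a0; rewrite mulr_ge0 ?sqr_ge0// ltW.
have nn2 (a x : R) : 0 < a -> 0 <= a * (2%:R^-1 * x ^+ 2).
  by move=> a0; rewrite mulrA; apply: nn; rewrite mulr_gt0// invr_gt0.
rewrite lt_neqAle eq_sym !addr_ge0 ?nn ?nn2// andbT.
apply: contraNN v0 => /eqP.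
set x0 := v 0 (inord 0); set x1 := v 0 (inord 1).
set x2 := v 0 (inord 2); set x3 := v 0 (inord 3).
set x4 := v 0 (inord 4); set x5 := v 0 (inord 5) => E.
have z (a x : R) : 0 < a -> a * x ^+ 2 <= 0 -> x = 0.
  move=> a0; rewrite pmulr_rle0// => x0'; apply/eqP.
  by rewrite -sqrf_eq0 eq_le x0' sqr_ge0.
have z2 (a x : R) : 0 < a -> a * (2%:R^-1 * x ^+ 2) <= 0 -> x = 0.
  by move=> a0; rewrite mulrA; apply: z; rewrite mulr_gt0// invr_gt0.
have g0 := nn _ x0 AB; have g1 := nn _ x1 CD; have g2 := nn _ x2 AC.
have g3 := nn _ x3 BD; have g4 := nn2 _ (x4 + x5) AD.
have g5 := nn2 _ (x4 - x5) BC.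
have X0 : x0 = 0 by apply: (z _ _ AB); lra.
have X1 : x1 = 0 by apply: (z _ _ CD); lra.
have X2 : x2 = 0 by apply: (z _ _ AC); lra.
have X3 : x3 = 0 by apply: (z _ _ BD); lra.
have Xp : x4 + x5 = 0 by apply: (z2 _ _ AD); lra.
have Xm : x4 - x5 = 0 by apply: (z2 _ _ BC); lra.
have X4 : x4 = 0 by lra.
have X5 : x5 = 0 by lra.
apply/eqP/row6_eq0 => -[|[|[|[|[|[|//]]]]]] _;
  [exact: X0|exact: X1|exact: X2|exact: X3|exact: X4|exact: X5].
Qed.

Definition sol_dc : 'I_6 -> 'I_6 -> 'I_6 -> R :=
  fun k i j => nth 0 (sol_structure R) k i j.

Lemma rep_sol_dc (env : seq R) l : pev env l = sol_constant R ->
  rep3 env (psol_structure l) sol_dc.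
Proof.
move=> hl k i j; rewrite /sol_dc /sol_structure /psol_structure.
case: k => -[|[|[|[|[|[|//]]]]]] /= _; rewrite mxE//.
- by rewrite pevN pevM hl -rep_e2 mulNr.
- by rewrite pevM hl -rep_e2.
- by rewrite pevN pevM hl -rep_e2 mulNr.
- by rewrite pevM hl -rep_e2.
Qed.

Let rep_dc s : rep3 (sol_env A B C D s) (psol_structure (pvar 5)) sol_dc.
Proof. by apply: rep_sol_dc; rewrite pev_var. Qed.

Lemma sol_closed i j k l : linv_d3 sol_dc (sol_form A B C D) i j k l = 0.
Proof. by apply: (closed_okP (rep_dc [::]) (sol_rep _ _ _ _ [::])); vm_compute. Qed.

Lemma sol_flow i j k : let c := 16%:R * sol_constant R ^+ 2 in
  linv_flow sol_dc (sol_form A B C D) i j k =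
  sol_form (c * (A * B * C)) (c * (A * B * D)) (c * (A * C * D))
    (c * (B * C * D)) i j k.
Proof.
move=> c.
rewrite (geoflow_rep (@sol_relations [::]) (@sol_rep _ _ _ _ _) (@sol_ps_gt0 _)
             sol_geo_ok (rep_dc _)).
pose pc := pmul (pint 16) (pmul (pvar 5) (pvar 5)).
pose t i j k := pmul pc (pmul (pmul (pvar i) (pvar j)) (pvar k)).
pose ph := tab3 (psol_form (t 0%N 1%N 2%N) (t 0%N 1%N 3%N) (t 0%N 2%N 3%N)
                           (t 1%N 2%N 3%N)).
transitivity (pev (sol_env A B C D [::]) (ph i j k)); last first.
  symmetry; apply: (rep_sol_form (env := sol_env A B C D [::]));
    by rewrite 2!pevM 2!pevM pev_int !pevM !pev_var.
apply: (peq_modP (@sol_relations [::])).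
suff : let F := geoflow sol_ms sol_ph sol_pis (psol_structure (pvar 5)) in
    let F' := ph in
    all6 (fun i => all6 (fun j => all6 (fun k =>
      peq_mod sol_ms (F i j k) (F' i j k)))).
  by move=> /all6P/(_ i)/all6P/(_ j)/all6P/(_ k).
by vm_compute.
Qed.

End Sol.

(** From g (J omega) = 1, with g = omega J and omega^2 = -1. *)
Lemma J_form_sq (R : realType) ms ph ps pis (env : seq R) (phi : form3 R) :
  relations env ms -> rep3 env ph phi -> 0 < pev env ps -> geo_ok ms ph ps pis ->
  J_form phi *m J_form phi = - 1%:M.
Proof.
move=> hm hphi hs ok; have := geo_inverse hm hphi hs ok.
rewrite /g_form /metric_of => E.
have o2 : omega R *m omega R = - 1%:M.
  by have := mulmx_omega env; rewrite mulmxN => /eqP; rewrite eqr_oppLR => /eqP.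
have -> : J_form phi *m J_form phi =
  omega R *m ((omega R *m J_form phi) *m (J_form phi *m omega R)) *m omega R.
  rewrite !mulmxA o2 -!mulmxA o2 !(mulmxN, mulNmx) opprK.
  by rewrite mulmx1 mul1mx.
by rewrite E mulmx1 o2.
Qed.

(** Where A D = B C, the square root of A B C D is B C, and Laurent monomials in
    A, B, C suffice to express J and g. *)
Section Limit.
Variables (R : realType) (A B C D : R).
Hypotheses (h : same_sign A B C D) (AD : A * D = B * C).

Let env : seq R := [:: A; B; C; A^-1; B^-1; C^-1; sol_constant R].
Let ms : seq mono := [:: [:: 1; 0; 0; 1]; [:: 0; 1; 0; 0; 1];
                         [:: 0; 0; 1; 0; 0; 1]]%N.
Let pD : pol := pmul (pmul (pvar 1) (pvar 2)) (pvar 3).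
Let ph : pform3 := tab3 (psol_form (pvar 0) (pvar 1) (pvar 2) pD).
Let ps : pol := pmul (pint 4) (pmul (pvar 1) (pvar 2)).
Let pis : pol := pmul (pfrac 4) (pmul (pvar 4) (pvar 5)).

Let A_neq0 : A != 0.
Proof. by case: h => AB _ _; apply: contraTneq AB => ->; rewrite mul0r ltxx. Qed.

Let B_neq0 : B != 0.
Proof. by case: h => AB _ _; apply: contraTneq AB => ->; rewrite mulr0 ltxx. Qed.

Let C_neq0 : C != 0.
Proof. by case: h => _ hAC _; apply: contraTneq hAC => ->; rewrite mulr0 ltxx. Qed.

Let hm : relations env ms.
Proof.
by move=> n; rewrite !inE => /or3P[] /eqP -> /=;
  rewrite ?expr0 ?mul1r !expr1 mulr1 mulfV.
Qed.

Let hr : rep3 env ph (sol_form A B C D).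
Proof.
apply: rep_sol_form; rewrite ?pev_var//.
by rewrite 2!pevM !pev_var//= -AD mulrAC mulfV// mul1r.
Qed.

Let hs : 0 < pev env ps.
Proof.
rewrite 2!pevM pev_int !pev_var//; apply: mulr_gt0 => //=.
by rewrite -AD; case: h.
Qed.

Let ok : geo_ok ms ph ps pis. Proof. by vm_compute. Qed.

Let hdc : rep3 env (psol_structure (pvar 6)) (@sol_dc R).
Proof. by apply: rep_sol_dc; rewrite pev_var. Qed.

(** The Ricci tensor is - 2 lambda^2 ((e^5)^2 + (e^6)^2), and J acts on the span
    of e_5 and e_6 as a rotation. *)
Lemma sol_ricci_invariant i j :
  let phi := sol_form A B C D in let J := J_form phi in
  let Ric := linv_ricci (@sol_dc R) (g_form phi) in
  Ric i j = \sum_k \sum_l Ric k l * J k i * J l j.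
Proof.
move=> phi J Ric.
have hRic := georicci_rep hm hr hs ok hdc; have hJ := geoJ_rep hm hr hs ok.
pose pRic := georicci ms ph pis (psol_structure (pvar 6)).
pose pJ := geoJ ms ph pis.
transitivity (pev env (psum (fun k => psum (fun l =>
    lmul (pRic k l) (fun _ => lmul (pJ k i) (fun _ => pJ l j)))))); last first.
  rewrite pev_sum; apply: eq_bigr => k _; rewrite pev_sum; apply: eq_bigr => l _.
  by rewrite 2!pev_lmul -hRic -!hJ mulrA.
rewrite /Ric hRic; apply: (peq_modP hm).
suff : let Q := pRic in let P := pJ in all6 (fun i => all6 (fun j => peq_mod ms (Q i j)
    (psum (fun k => psum (fun l =>
      lmul (Q k l) (fun _ => lmul (P k i) (fun _ => P l j))))))).
  by move=> /all6P/(_ i)/all6P/(_ j).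
by vm_compute.
Qed.

Lemma sol_J_sq : J_form (sol_form A B C D) *m J_form (sol_form A B C D) = - 1%:M.
Proof. exact: (J_form_sq hm hr hs ok). Qed.

End Limit.

(** * Left-invariant tensor fields *)

Section LeftInvariant.
Variables (R : realType) (e : coframe R) (dc : 'I_6 -> 'I_6 -> 'I_6 -> R).
Hypothesis hdc : forall x k i j, dcoframe e x k i j = dc k i j.

Lemma frame_deriv_cst i (c : R) x : frame_deriv e i (fun=> c) x = 0.
Proof. by rewrite /frame_deriv derive_cst. Qed.

Lemma d3_cst (phi : form3 R) x i j k l :
  d3 e (fun=> phi) x i j k l = linv_d3 dc phi i j k l.
Proof.
rewrite /d3 !frame_deriv_cst !subr0 !add0r.
by apply: eq_bigr => m _; rewrite !hdc.
Qed.

Lemma d2_cst (b : 'M[R]_6) x i j k :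
  d2 e (fun=> b) x i j k = linv_d2 dc b i j k.
Proof.
rewrite /d2 !frame_deriv_cst !subr0 !add0r.
by apply: eq_bigr => m _; rewrite !hdc.
Qed.

Lemma typeIIA_rhs_cst (phi : form3 R) x i j k :
  typeIIA_rhs e (fun=> phi) x i j k = linv_flow dc phi i j k.
Proof.
rewrite /typeIIA_rhs /linv_flow -(d2_cst _ x); congr (d2 e _ x i j k).
apply/funext => y; apply/matrixP => a b; rewrite !mxE; congr (_ * _).
apply: eq_bigr => c _; apply: eq_bigr => d _; congr (_ * _).
exact: d3_cst.
Qed.

Lemma lie_bracket_cst (X Y : 'rV[R]_6) x k :
  lie_bracket e (fun=> X) (fun=> Y) x 0 k =
  - \sum_i \sum_j X 0 i * Y 0 j * dc k i j.
Proof.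
rewrite mxE big1 ?sub0r; last by move=> i _; rewrite !frame_deriv_cst !mulr0 subr0.
by congr (- _); apply: eq_bigr => i _; apply: eq_bigr => j _; rewrite hdc.
Qed.

Lemma nijenhuis_cst (J : 'M[R]_6) x i j k :
  nijenhuis e (fun=> J) x j k 0 i = linv_nijenhuis dc J i j k.
Proof.
have Jd (a b : 'I_6) : ((delta_mx 0 a : 'rV[R]_6) *m J^T) 0 b = J b a.
  by rewrite -rowE !mxE.
have br0 (X Y : 'I_6) : lie_bracket e (fun=> delta_mx 0 X) (fun=> delta_mx 0 Y) x 0 i
    = - dc i X Y.
  rewrite lie_bracket_cst (bigD1 X)//= (bigD1 Y)//= !mxE !eqxx !mul1r !big1 ?addr0//.
    move=> a aX; rewrite big1// => b _; rewrite !mxE (negPf aX) andbF.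
    by rewrite mul0r mul0r.
  by move=> b bY; rewrite !mxE (negPf bY) andbF mulr0 mul0r.
rewrite /nijenhuis /linv_nijenhuis mxE; congr (_ * _).
have mxB (X Y : 'rV[R]_6) : (X - Y) 0 i = X 0 i - Y 0 i by rewrite !mxE.
have mxJ (X : 'rV[R]_6) : (X *m J^T) 0 i = \sum_m J i m * X 0 m.
  by rewrite mxE; apply: eq_bigr => m _; rewrite mxE mulrC.
have dR (F : 'I_6 -> R) (a : 'I_6) : \sum_b F b * (delta_mx 0 a : 'rV[R]_6) 0 b = F a.
  rewrite (bigD1 a)//= big1 ?addr0 ?mxE ?eqxx ?mulr1// => b ba.
  by rewrite mxE (negPf ba) andbF mulr0.
rewrite !mxB br0 opprK !mxJ lie_bracket_cst; congr (_ + _ + _ + _).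
- by congr (- _); apply: eq_bigr => a _; apply: eq_bigr => b _; rewrite !Jd.
- rewrite -sumrN; apply: eq_bigr => m _; rewrite lie_bracket_cst mulrN opprK.
  rewrite mulr_sumr; apply: eq_bigr => a _; rewrite Jd.
  under eq_bigr do rewrite mulrAC.
  by rewrite (dR (fun b => J a j * dc m a b)) mulrA.
- rewrite -sumrN; apply: eq_bigr => m _; rewrite lie_bracket_cst mulrN opprK.
  rewrite exchange_big mulr_sumr; apply: eq_bigr => a _; rewrite Jd.
  under eq_bigr => b _ do rewrite -mulrA mulrC.
  by rewrite (dR (fun b => J a k * dc m b a)) mulrA.
Qed.

Lemma nijenhuis_norm_cst (phi : form3 R) x : let g := g_form phi in
  let N := linv_nijenhuis dc (J_form phi) in
  nijenhuis_norm e (fun=> phi) x = Num.sqrt (\sum_i \sum_j \sum_k \sum_a \sum_b \sum_c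
    g i a * invmx g j b * invmx g k c * N i j k * N a b c).
Proof.
rewrite /= /nijenhuis_norm; congr Num.sqrt.
do 6![apply: eq_bigr => ? _].
by rewrite !nijenhuis_cst.
Qed.

Lemma christoffel_cst (g : 'M[R]_6) x i j l :
  christoffel e (fun=> g) x i j l = linv_christoffel dc g i j l.
Proof.
rewrite /christoffel /linv_christoffel; congr (_ * _); apply: eq_bigr => k _.
rewrite !frame_deriv_cst addr0 subr0 add0r; congr (_ * (- _ - - _ - - _));
  by apply: eq_bigr => m _; rewrite hdc.
Qed.

Lemma ricci_cst (g : 'M[R]_6) x j k : ricci e (fun=> g) x j k = linv_ricci dc g j k.
Proof.
rewrite mxE; apply: eq_bigr => i _.
have E a b c d : frame_deriv e d (fun y => christoffel e (fun=> g) y a b c) x = 0.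
  rewrite -[RHS](frame_deriv_cst d (linv_christoffel dc g a b c) x).
  by congr (frame_deriv e d _ x); apply/funext => y; rewrite christoffel_cst.
rewrite !E subr0 add0r; apply: eq_bigr => l _.
by rewrite !christoffel_cst hdc.
Qed.

End LeftInvariant.

(** * One-variable calculus *)

Section Calculus.
Variable R : realType.
Implicit Types (f g : R -> R) (x : R).

Definition has_deriv x f (df : R) : Prop :=
  is_derive (x : R^o) (1 : R^o) (f : R^o -> R^o) df.

Lemma has_deriv_eq x f df df' : has_deriv x f df -> df = df' -> has_deriv x f df'.
Proof. by move=> h <-. Qed.

Lemma has_deriv_cst x (c : R) : has_deriv x (fun=> c) 0.
Proof. exact: is_derive_cst. Qed.

Lemma has_deriv_id x : has_deriv x (fun s => s) 1.
Proof. exact: is_derive_id. Qed.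

Lemma has_derivD x f g df dg : has_deriv x f df -> has_deriv x g dg ->
  has_deriv x (fun s => f s + g s) (df + dg).
Proof. exact: is_deriveD. Qed.

Lemma has_derivM x f g df dg : has_deriv x f df -> has_deriv x g dg ->
  has_deriv x (fun s => f s * g s) (df * g x + f x * dg).
Proof.
move=> hf hg; apply: (has_deriv_eq (is_deriveM hf hg)).
by rewrite /GRing.scale /= addrC mulrC.
Qed.

Lemma has_deriv_sum (I : Type) (s : seq I) (f : I -> R -> R) (df : I -> R) x :
  (forall i, has_deriv x (f i) (df i)) ->
  has_deriv x (fun t => \sum_(i <- s) f i t) (\sum_(i <- s) df i).
Proof.
move=> h; elim: s => [|i s IH].
  rewrite big_nil (_ : (fun _ => _) = fun=> 0); first exact: has_deriv_cst.
  by apply/funext => t; rewrite big_nil.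
rewrite big_cons (_ : (fun _ => _) = fun t => f i t + \sum_(j <- s) f j t).
  exact: has_derivD.
by apply/funext => t; rewrite big_cons.
Qed.

Lemma has_deriv_comp x f g df dg : has_deriv x g dg -> has_deriv (g x) f df ->
  has_deriv x (fun s => f (g s)) (df * dg).
Proof. by move=> hg hf; exact: (@is_derive1_comp _ f g). Qed.

Lemma has_deriv_exp x (c : R) : has_deriv x (fun s => expR (c * s)) (c * expR (c * x)).
Proof.
have := has_deriv_comp (has_derivM (has_deriv_cst x c) (has_deriv_id x)) (is_derive_expR (c * x)).
by move=> h; apply: (has_deriv_eq h); rewrite mul0r mulr1 add0r mulrC.
Qed.

Lemma has_deriv_continuous x f df : has_deriv x f df -> {for x, continuous f}.
Proof. by move=> [h _]; exact/differentiable_continuous/derivable1_diffP. Qed.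

Lemma cvg_sumR (T I : Type) (F : set_system T) (FF : Filter F) (s : seq I)
    (f : I -> T -> R) (l : I -> R) :
  (forall i, f i x @[x --> F] --> l i) ->
  \sum_(i <- s) f i x @[x --> F] --> \sum_(i <- s) l i.
Proof.
move=> h; elim: s => [|i s IH].
  rewrite big_nil; under eq_fun do rewrite big_nil; exact: cvg_cst.
by rewrite big_cons; under eq_fun do rewrite big_cons; exact: cvgD.
Qed.

End Calculus.

(** * Gronwall's inequality and Lipschitz pairs *)

(** The energy E = sum of the squares satisfies E' <= L E, so that
    exp (- L t) E t is nonincreasing. *)
Lemma gronwall (R : realType) (I : finType) (w w' : I -> R -> R) (t1 C : R) :
  0 <= t1 -> 0 <= C ->
  (forall k, {within `[0, t1], continuous (w k)}) ->
  (forall k t, t \in `]0, t1[ -> has_deriv t (w k) (w' k t)) ->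
  (forall k t, t \in `]0, t1[ -> `|w' k t| <= C * \sum_j `|w j t|) ->
  (forall k, w k 0 = 0) -> forall k, w k t1 = 0.
Proof.
move=> t10 C0 cw dw lw w0.
pose E t := \sum_k w k t * w k t.
pose E' t := \sum_k (2%:R * w k t * w' k t).
pose n : R := #|I|%:R; pose L := 2%:R * C * n.
have E'le t : t \in `]0, t1[ -> E' t <= L * E t.
  move=> ht; have S2 : (\sum_j `|w j t|) ^+ 2 <= n * E t.
    rewrite expr2 big_distrlr /= /n.
    apply: (@le_trans _ _ (\sum_i \sum_j (2%:R^-1 * (w i t * w i t + w j t * w j t)))).
      apply: ler_sum => i _; apply: ler_sum => j _.
      rewrite -!expr2 -[w i t ^+ 2]real_normK ?num_real// -[w j t ^+ 2]real_normK ?num_real//.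
      by have := sqr_ge0 (`|w i t| - `|w j t|); nra.
    under eq_bigr do rewrite -mulr_sumr big_split /= sumr_const.
    rewrite -mulr_sumr big_split /= sumr_const sumrMnl -/(E t) -mulr_natl.
    by lra.
  apply: (@le_trans _ _ (2%:R * C * (\sum_j `|w j t|) ^+ 2)); last first.
    by rewrite /L -(mulrA _ n) ler_wpM2l// mulr_ge0.
  rewrite expr2 mulrA mulr_sumr; apply: ler_sum => k _.
  apply: (le_trans (ler_norm _)); rewrite !normrM ger0_norm//.
  have := lw k t ht; have := normr_ge0 (w k t).
  by move: (\sum_j _) => S; nra.
pose G t := expR (- L * t) * E t.
pose G' t := expR (- L * t) * (E' t - L * E t).
have cE x : x \in `[0, t1] -> E y @[y --> within `[0, t1] (nbhs x)] --> E x.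
  move=> xI; apply: cvg_sumR => k.
  have ck : w k y @[y --> within `[0, t1] (nbhs x)] --> w k x.
    by have /subspace_continuousP := cw k; apply.
  exact: cvgM.
have cG : {within `[0, t1], continuous G}.
  apply/subspace_continuousP => x xI; apply: cvgM; last exact: cE.
  apply: cvg_within_filter.
  exact: (has_deriv_continuous (has_deriv_exp x (- L))).
have dG t : t \in `]0, t1[ -> has_deriv t G (G' t).
  move=> ht; have dE : has_deriv t E (E' t).
    by apply: has_deriv_sum => k; apply: (has_deriv_eq (has_derivM (dw k t ht) (dw k t ht))); ring.
  by apply: (has_deriv_eq (has_derivM (has_deriv_exp t (- L)) dE)); rewrite /G'; ring.
have E0 : E 0 = 0 by rewrite /E big1// => k _; rewrite w0 mulr0.
have Et1 : E t1 <= 0.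
  move: t10; rewrite le_eqVlt => /predU1P[<-|t1_gt0]; first by rewrite E0.
  have [c ct] := MVT t1_gt0 dG cG.
  rewrite subr0 {2}/G E0 mulr0 subr0 => Gt.
  have : G t1 <= 0.
    rewrite Gt pmulr_lle0// /G' pmulr_rle0 ?expR_gt0// subr_le0.
    exact: E'le.
  by rewrite /G pmulr_rle0// expR_gt0.
move=> k; apply/eqP; rewrite -sqrf_eq0 eq_le sqr_ge0 andbT expr2.
apply: le_trans Et1; rewrite /E (bigD1 k)//= lerDl sumr_ge0// => j _.
by rewrite -expr2 sqr_ge0.
Qed.

Section LipschitzPairs.
Variables (R : realType) (t1 : R) (Dist : R -> R).
Hypothesis t1_ge0 : 0 <= t1.

(** Two solutions are compared along their common time interval, where [Dist] is
    their distance.  Continuity supplies the bounds from above and below that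
    products, inverses and square roots need; no neighbourhood of the
    solutions has to be considered. *)
Definition lip_pair (f g : R -> R) : Prop :=
  [/\ {within `[0, t1], continuous f}, {within `[0, t1], continuous g} &
      exists2 C, 0 <= C &
        forall t, t \in `[0, t1] -> `|f t - g t| <= C * Dist t].

Let cvgw (f : R -> R) x : {within `[0, t1], continuous f} -> x \in `[0, t1] ->
  f y @[y --> within `[0, t1] (nbhs x)] --> f x.
Proof. by move=> /subspace_continuousP h xI; exact: h. Qed.

Let bounded_on (f : R -> R) : {within `[0, t1], continuous f} ->
  exists2 M, 0 <= M & forall t, t \in `[0, t1] -> `|f t| <= M.
Proof.
move=> cf.
have cn : {within `[0, t1], continuous (fun t => `|f t|)}.
  apply/subspace_continuousP => x xI.
  by apply: cvg_norm; exact: cvgw.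
by have [c cI hc] := EVT_max t1_ge0 cn; exists `|f c|.
Qed.

Lemma lip_cst (c : R) : lip_pair (fun=> c) (fun=> c).
Proof.
split; try by apply/subspace_continuousP => x xI; exact: cvg_cst.
by exists 0 => // t _; rewrite subrr normr0 mul0r.
Qed.

Lemma lip_ext f g f' g' : {in `[0, t1], f =1 f'} -> {in `[0, t1], g =1 g'} ->
  lip_pair f g -> lip_pair f' g'.
Proof.
move=> ff gg [cf cg [C C0 hC]]; split.
- by apply: subspace_eq_continuous cf => x; rewrite inE => /ff.
- by apply: subspace_eq_continuous cg => x; rewrite inE => /gg.
- by exists C => // t tI; rewrite -ff// -gg// hC.
Qed.

Lemma lipD f g f' g' : lip_pair f g -> lip_pair f' g' ->
  lip_pair (fun t => f t + f' t) (fun t => g t + g' t).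
Proof.
move=> [cf cg [C C0 hC]] [cf' cg' [C' C'0 hC']]; split.
- by apply/subspace_continuousP => x xI; apply: cvgD; exact: cvgw.
- by apply/subspace_continuousP => x xI; apply: cvgD; exact: cvgw.
exists (C + C') => [|t tI]; first exact: addr_ge0.
rewrite opprD addrACA mulrDl; apply: (le_trans (ler_normD _ _)).
by apply: lerD; [exact: hC | exact: hC'].
Qed.

Lemma lipM f g f' g' : lip_pair f g -> lip_pair f' g' ->
  lip_pair (fun t => f t * f' t) (fun t => g t * g' t).
Proof.
move=> [cf cg [C C0 hC]] [cf' cg' [C' C'0 hC']]; split.
- by apply/subspace_continuousP => x xI; apply: cvgM; exact: cvgw.
- by apply/subspace_continuousP => x xI; apply: cvgM; exact: cvgw.
have [M M0 hM] := bounded_on cf'; have [N N0 hN] := bounded_on cg.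
exists (C * M + N * C') => [|t tI]; first by rewrite addr_ge0// mulr_ge0.
rewrite (_ : _ - _ = (f t - g t) * f' t + g t * (f' t - g' t)); last by ring.
apply: (le_trans (ler_normD _ _)); rewrite !normrM mulrDl.
apply: lerD.
  by rewrite mulrAC ler_pM// ?hC ?hM.
by rewrite -mulrA ler_pM// ?hC' ?hN.
Qed.

Lemma lipN f g : lip_pair f g -> lip_pair (fun t => - f t) (fun t => - g t).
Proof.
move=> h; have := lipM (lip_cst (-1)) h.
by apply: lip_ext => t _; rewrite mulN1r.
Qed.

Lemma lipB f g f' g' : lip_pair f g -> lip_pair f' g' ->
  lip_pair (fun t => f t - f' t) (fun t => g t - g' t).
Proof. by move=> h h'; apply: lipD => //; exact: lipN. Qed.

Lemma lip_sum (I : Type) (s : seq I) (f g : I -> R -> R) :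
  (forall i, lip_pair (f i) (g i)) ->
  lip_pair (fun t => \sum_(i <- s) f i t) (fun t => \sum_(i <- s) g i t).
Proof.
move=> h; elim: s => [|i s IH].
  by apply: lip_ext (lip_cst 0) => t _; rewrite big_nil.
by apply: lip_ext (lipD (h i) IH) => t _; rewrite big_cons.
Qed.

Lemma lip_prod (I : Type) (s : seq I) (f g : I -> R -> R) :
  (forall i, lip_pair (f i) (g i)) ->
  lip_pair (fun t => \prod_(i <- s) f i t) (fun t => \prod_(i <- s) g i t).
Proof.
move=> h; elim: s => [|i s IH].
  by apply: lip_ext (lip_cst 1) => t _; rewrite big_nil.
by apply: lip_ext (lipM (h i) IH) => t _; rewrite big_cons.
Qed.

Let cvgwV (f : R -> R) : {within `[0, t1], continuous f} ->
  (forall t, t \in `[0, t1] -> f t != 0) ->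
  {within `[0, t1], continuous (fun t => (f t)^-1)}.
Proof.
move=> cf f0; apply/subspace_continuousP => x xI.
by apply: cvgV; [exact: f0 | exact: cvgw].
Qed.

Lemma lipV f g : (forall t, t \in `[0, t1] -> f t != 0) ->
  (forall t, t \in `[0, t1] -> g t != 0) ->
  lip_pair f g -> lip_pair (fun t => (f t)^-1) (fun t => (g t)^-1).
Proof.
move=> f0 g0 [cf cg [C C0 hC]].
have cf' := cvgwV cf f0; have cg' := cvgwV cg g0; split => //.
have [M M0 hM] := bounded_on cf'; have [N N0 hN] := bounded_on cg'.
exists (M * N * C) => [|t tI]; first by rewrite !mulr_ge0.
rewrite (_ : _ - _ = (f t)^-1 * (g t)^-1 * (g t - f t)); last first.
  by field; rewrite f0// g0.
rewrite !normrM (distrC (g t)) -[leRHS]mulrA; apply: ler_pM; rewrite ?mulr_ge0//.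
  by apply: ler_pM => //; [exact: hM | exact: hN].
exact: hC.
Qed.

(** Away from zero the square root is Lipschitz whatever the signs, because
    it vanishes on negative numbers. *)
Lemma lip_sqrt f g : (forall t, t \in `[0, t1] -> f t != 0) ->
  (forall t, t \in `[0, t1] -> g t != 0) ->
  lip_pair f g -> lip_pair (fun t => Num.sqrt (f t)) (fun t => Num.sqrt (g t)).
Proof.
move=> f0 g0 [cf cg [C C0 hC]].
have cs (u : R -> R) : {within `[0, t1], continuous u} ->
    {within `[0, t1], continuous (fun t => Num.sqrt (u t))}.
  move=> cu; apply/subspace_continuousP => x xI.
  by apply: cvg_comp (cvgw cu xI) _; exact: sqrt_continuous.
split; [exact: cs | exact: cs |].
have hs (u : R -> R) : {within `[0, t1], continuous u} ->
    (forall t, t \in `[0, t1] -> u t != 0) ->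
    exists2 M, 0 <= M & forall t, t \in `[0, t1] -> 0 < u t ->
      1 <= M * Num.sqrt (u t).
  move=> cu u0.
  have [M M0 hM] := bounded_on (cvgwV cu u0).
  exists (M + 1); first by rewrite addr_ge0.
  move=> t tI ut; have := hM t tI; rewrite gtr0_norm ?invr_gt0// => h.
  have s0 : 0 < Num.sqrt (u t) by rewrite sqrtr_gt0.
  have s2 : Num.sqrt (u t) ^+ 2 = u t by rewrite sqr_sqrtr// ltW.
  have Mu : 1 <= M * u t by rewrite -ler_pdivrMr// mul1r.
  move: Mu; rewrite -{1}s2; move: s0; move: (Num.sqrt _) => s s0 Mu.
  have Ms : 0 <= M * s by rewrite mulr_ge0// ltW.
  have [s1|s1] := leP 1 s; first by lra.
  have : M * s * s <= M * s by rewrite ler_piMr// ltW.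
  by rewrite -mulrA -expr2; lra.
have [M M0 hM] := hs f cf f0; have [N N0 hN] := hs g cg g0.
exists ((M + N) * C) => [|t tI]; first by rewrite mulr_ge0// addr_ge0.
rewrite -mulrA; apply: (@le_trans _ _ ((M + N) * `|f t - g t|)); last first.
  by apply: ler_wpM2l; [exact: addr_ge0 | exact: hC].
have d0 := normr_ge0 (f t - g t).
have aux (K x y : R) : 0 <= K -> 0 < x -> 1 <= K * Num.sqrt x ->
    `|Num.sqrt x - Num.sqrt y| <= K * `|x - y|.
  move=> K0 x0 Kx.
  have sx : Num.sqrt x ^+ 2 = x by rewrite sqr_sqrtr// ltW.
  have sx0 : 0 < Num.sqrt x by rewrite sqrtr_gt0.
  have sy0 := sqrtr_ge0 y.
  have [y0|y0] := leP y 0.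
    rewrite (ler0_sqrtr y0) subr0 (ger0_norm (sqrtr_ge0 x)).
    have Kxx : Num.sqrt x <= K * Num.sqrt x * Num.sqrt x by rewrite ler_peMl// ltW.
    have Ky : 0 <= K * - y by rewrite mulr_ge0// oppr_ge0.
    rewrite (ger0_norm (_ : 0 <= x - y)); last first.
      by rewrite subr_ge0 (le_trans y0)// ltW.
    rewrite (_ : K * (x - y) = K * Num.sqrt x * Num.sqrt x + K * - y); first by lra.
    by rewrite -(mulrA K) -expr2 sx; ring.
  have sy : Num.sqrt y ^+ 2 = y by rewrite sqr_sqrtr// ltW.
  rewrite -[X in X - y]sx -[X in _ - X]sy subr_sqr normrM.
  rewrite (ger0_norm (_ : 0 <= Num.sqrt x + Num.sqrt y)); last first.
    by rewrite addr_ge0// ltW.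
  have n0 := normr_ge0 (Num.sqrt x - Num.sqrt y).
  by rewrite mulrCA ler_peMr// mulrDr (le_trans Kx)// lerDl mulr_ge0.
have [ft|ft] := ltP 0 (f t).
  apply: (le_trans (aux M _ _ M0 ft (hM t tI ft))).
  by rewrite ler_wpM2r// lerDl.
have [gt|gt] := ltP 0 (g t).
  rewrite distrC; apply: (le_trans (aux N _ _ N0 gt (hN t tI gt))).
  by rewrite distrC ler_wpM2r// lerDr.
by rewrite !ler0_sqrtr// subrr normr0 mulr_ge0// addr_ge0.
Qed.

End LipschitzPairs.

(** * The flow is Lipschitz along two positive solutions *)

Lemma posdef_unitmx (R : realType) (g : 'M[R]_6) : posdef g -> g \in unitmx.
Proof.
move=> [_ pd]; rewrite -row_free_unit -kermx_eq0; apply/negPn/negP => k0.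
have [v vk v0] := rowV0Pn k0.
have := pd _ v0; move/sub_kermxP: vk => ->.
by rewrite mul0mx mxE ltxx.
Qed.

Section FlowLipschitz.
Variables (R : realType) (t1 : R) (Dist : R -> R).
Hypothesis t1_ge0 : 0 <= t1.
Local Notation lip := (lip_pair t1 Dist).

Definition lip_mx (A B : R -> 'M[R]_6) : Prop :=
  forall i j, lip (fun t => A t i j) (fun t => B t i j).

Definition lip_form (p q : R -> form3 R) : Prop :=
  forall i j k, lip (fun t => p t i j k) (fun t => q t i j k).

Let lipC (c : R) : lip (fun=> c) (fun=> c).
Proof. exact: lip_cst. Qed.

Let lip_mul f g f' g' : lip f g -> lip f' g' ->
  lip (fun t => f t * f' t) (fun t => g t * g' t).
Proof. exact: lipM. Qed.

Lemma lip_mxE (m n : nat) (f g : R -> 'I_m -> 'I_n -> R) i j :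
  lip (fun t => f t i j) (fun t => g t i j) ->
  lip (fun t => (\matrix_(i, j) f t i j) i j) (fun t => (\matrix_(i, j) g t i j) i j).
Proof. by apply: lip_ext => t _; rewrite mxE. Qed.

Lemma lip_mulmx A B A' B' : lip_mx A B -> lip_mx A' B' ->
  lip_mx (fun t => A t *m A' t) (fun t => B t *m B' t).
Proof.
move=> h h' i j.
apply: (lip_ext (f := fun t => \sum_k A t i k * A' t k j)
                (g := fun t => \sum_k B t i k * B' t k j)).
- by move=> t _; rewrite mxE.
- by move=> t _; rewrite mxE.
- by apply: lip_sum => k; apply: lip_mul.
Qed.

Lemma lip_det (n : nat) (A B : R -> 'M[R]_n) :
  (forall i j, lip (fun t => A t i j) (fun t => B t i j)) ->
  lip (fun t => \det (A t)) (fun t => \det (B t)).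
Proof.
move=> h; apply: lip_sum => s; apply: lip_mul; first exact: lipC.
by apply: lip_prod.
Qed.

Lemma lip_invmx A B : lip_mx A B ->
  (forall t, t \in `[0, t1] -> A t \in unitmx) ->
  (forall t, t \in `[0, t1] -> B t \in unitmx) ->
  lip_mx (fun t => invmx (A t)) (fun t => invmx (B t)).
Proof.
move=> h uA uB i j.
apply: (lip_ext (f := fun t => (\det (A t))^-1 * cofactor (A t) j i)
                (g := fun t => (\det (B t))^-1 * cofactor (B t) j i)).
- by move=> t tI; rewrite /invmx uA// !mxE.
- by move=> t tI; rewrite /invmx uB// !mxE.
apply: lip_mul.
  apply: lipV => //; last exact: lip_det.
  - by move=> t /uA; rewrite unitmxE unitfE.
  - by move=> t /uB; rewrite unitmxE unitfE.
apply: lip_mul; first exact: lipC.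
apply: lip_det => k l.
by apply: (lip_ext _ _ (h (lift j k) (lift i l))) => t _; rewrite !mxE.
Qed.

Lemma lip_K p q : lip_form p q ->
  lip_mx (fun t => K_form (p t)) (fun t => K_form (q t)).
Proof.
move=> h i v; apply: (lip_mxE
  (f := fun t i v => - (12%:R^-1 * \sum_j \sum_k \sum_l \sum_m \sum_n
    levi_civita R i j k l m n * p t v j k * p t l m n))
  (g := fun t i v => - (12%:R^-1 * \sum_j \sum_k \sum_l \sum_m \sum_n
    levi_civita R i j k l m n * q t v j k * q t l m n))).
apply: lipN => //; apply: lip_mul; first exact: lipC.
do 5![apply: lip_sum => ?].
by apply: lip_mul => //; apply: lip_mul => //; exact: lipC.
Qed.

Lemma lip_raise3 (g g' : R -> 'M[R]_6) p q :
  lip_mx (fun t => invmx (g t)) (fun t => invmx (g' t)) -> lip_form p q ->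
  lip_form (fun t => raise3 (g t) (p t)) (fun t => raise3 (g' t) (q t)).
Proof.
move=> hg h i j k; do 3![apply: lip_sum => ?].
by do 3![apply: lip_mul => //].
Qed.

Variables (p q : R -> form3 R).
Hypothesis pq : lip_form p q.
Hypotheses (pp : forall t, t \in `[0, t1] -> positive (p t))
           (pos_q : forall t, t \in `[0, t1] -> positive (q t)).

Let lip_lambda :
  lip (fun t => - lambda_form (p t)) (fun t => - lambda_form (q t)).
Proof.
apply: lipN => //; apply: lip_mul; first exact: lipC.
by apply: lip_sum => i; apply: lip_mulmx; apply: lip_K.
Qed.

Let lip_g : lip_mx (fun t => g_form (p t)) (fun t => g_form (q t)).
Proof.
apply: lip_mulmx; first by move=> i j; exact: lipC.
move=> i j.
apply: (lip_ext
  (f := fun t => (Num.sqrt (- lambda_form (p t)))^-1 * K_form (p t) i j)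
  (g := fun t => (Num.sqrt (- lambda_form (q t)))^-1 * K_form (q t) i j)).
- by move=> t _; rewrite [RHS]mxE.
- by move=> t _; rewrite [RHS]mxE.
apply: lip_mul; last exact: lip_K.
have pl (s : R -> form3 R) : (forall t, t \in `[0, t1] -> positive (s t)) ->
    forall t, t \in `[0, t1] -> 0 < - lambda_form (s t).
  by move=> hs t /hs[_ + _]; rewrite oppr_gt0.
apply: lipV => //; last apply: lip_sqrt => //.
- by move=> t tI; rewrite gt_eqF// sqrtr_gt0 pl.
- by move=> t tI; rewrite gt_eqF// sqrtr_gt0 pl.
- by move=> t tI; rewrite gt_eqF// pl.
- by move=> t tI; rewrite gt_eqF// pl.
Qed.

Let up t : t \in `[0, t1] -> g_form (p t) \in unitmx.
Proof. by move=> /pp[_ _]; exact: posdef_unitmx. Qed.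

Let uq t : t \in `[0, t1] -> g_form (q t) \in unitmx.
Proof. by move=> /pos_q[_ _]; exact: posdef_unitmx. Qed.

Let lip_raise : lip_form (fun t => raise3 (g_form (p t)) (p t))
                         (fun t => raise3 (g_form (q t)) (q t)).
Proof. by apply: lip_raise3 => //; apply: lip_invmx. Qed.

Let lip_flux : lip_form
  (fun t i j k => norm2_form (p t) * star (p t) i j k)
  (fun t i j k => norm2_form (q t) * star (q t) i j k).
Proof.
move=> l m n; apply: lip_mul.
  apply: lip_mul; first exact: lipC.
  by do 3![apply: lip_sum => ?]; apply: lip_mul.
apply: lip_mul.
  apply: lip_mul; first exact: lipC.
  apply: lip_sqrt => //; last exact: lip_det.
  - by move=> t /up; rewrite unitmxE unitfE.
  - by move=> t /uq; rewrite unitmxE unitfE.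
by do 3![apply: lip_sum => ?]; apply: lip_mul => //; exact: lipC.
Qed.

Lemma lip_flow (dc : 'I_6 -> 'I_6 -> 'I_6 -> R) :
  lip_form (fun t => linv_flow dc (p t)) (fun t => linv_flow dc (q t)).
Proof.
have hL : lip_mx
    (fun t => Lambda4 (linv_d3 dc
       (fun i j k => norm2_form (p t) * star (p t) i j k)))
    (fun t => Lambda4 (linv_d3 dc
       (fun i j k => norm2_form (q t) * star (q t) i j k))).
  move=> k l; apply: lip_mxE; apply: lip_mul; first exact: lipC.
  do 2![apply: lip_sum => ?]; apply: lip_mul; first exact: lipC.
  apply: lip_sum => m.
  by repeat first [ apply: lipB => // | apply: lipD | apply: lip_mul; [exact: lipC | exact: lip_flux]].
move=> i j k; apply: lip_sum => l.
by repeat first [ apply: lipB => // | apply: lipD | apply: lip_mul; [exact: lipC | exact: hL]].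
Qed.

End FlowLipschitz.

(** * Smoothness in time and uniqueness *)

Lemma differentiable_near0 (R : realType) (V W : normedModType R) (u : V -> W) x :
  (\near x, u x = 0) -> differentiable u x.
Proof.
move=> u0; have ux : u x = 0 := nbhs_singleton u0.
have c0 : continuous (\0 : {linear V -> W}) by move=> y; exact: cvg_cst.
have E : u \o shift x = cst (u x) + (\0 : {linear V -> W}) +o_ (0 : V) id.
  apply/eqaddoP => e e0; rewrite ux.
  have : \forall h \near (0 : V), u (h + x) = 0.
    by move: u0; rewrite (near_shift 0) subr0.
  apply: filterS => h h0.
  rewrite (_ : (_ - _) h = 0) ?normr0 ?mulr_ge0 ?(ltW e0)//.
  by rewrite -[LHS]/(u (h + x) - (0 + 0)) h0 addr0 subr0.
by apply/diff_locallyP; rewrite (diff_unique c0 E).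
Qed.

Lemma near_eq_differentiable (R : realType) (V W : normedModType R) (f g : V -> W) x :
  (\near x, f x = g x) -> differentiable f x -> differentiable g x.
Proof.
move=> fg df; rewrite (_ : g = f + (g - f)); last by rewrite addrC subrK.
apply: differentiableD => //; apply: differentiable_near0.
by apply: filterS fg => y fgy; rewrite !fctE fgy subrr.
Qed.

Lemma Ck_on_ext (R : realType) (V W : normedModType R) k (U : set V) (f g : V -> W) :
  open U -> {in U, f =1 g} -> Ck_on k U f -> Ck_on k U g.
Proof.
move=> oU; elim: k f g => [|k IH] f g fg /=.
  move=> cf x Ux.
  have nfg : \near x, f x = g x.
    by apply: filterS (open_nbhs_nbhs (conj oU Ux)) => y Uy; apply: fg; rewrite inE.
  have gx : g x = f x by rewrite fg// inE.
  suff : g y @[y --> x] --> f x by rewrite -gx.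
  by apply: cvg_trans (cf x Ux); exact: near_eq_cvg.
move=> [df Dk].
have nfg x : U x -> \near x, f x = g x.
  move=> Ux; apply: filterS (open_nbhs_nbhs (conj oU Ux)) => y Uy.
  by apply: fg; rewrite inE.
split=> [x Ux|v]; first exact: near_eq_differentiable (nfg x Ux) (df x Ux).
by apply: IH (Dk v) => x; rewrite inE => Ux; exact: near_eq_derive (nfg x Ux).
Qed.

(** The components of the solutions lie in algebras of functions of time that
    are closed under differentiation, which yields derivatives of all orders
    at once. *)
Inductive generated (R : realType) (gens : (R -> R) -> Prop) : (R -> R) -> Prop :=
| gen_cst c : generated gens (fun=> c)
| gen_in f : gens f -> generated gens f
| gen_add f g : generated gens f -> generated gens g ->
    generated gens (fun t => f t + g t)
| gen_mul f g : generated gens f -> generated gens g ->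
    generated gens (fun t => f t * g t).

Lemma generated_deriv (R : realType) (gens : (R -> R) -> Prop) (I : set R) :
  (forall f, gens f -> exists2 f', generated gens f' &
     forall x, I x -> has_deriv x f (f' x)) ->
  forall f, generated gens f -> exists2 f', generated gens f' &
     forall x, I x -> has_deriv x f (f' x).
Proof.
move=> hg f; elim=> {f}.
- by move=> c; exists (fun=> 0); [exact: gen_cst | move=> x _; exact: has_deriv_cst].
- exact: hg.
- move=> f g _ [f' gf' hf] _ [g' gg' hg']; exists (fun t => f' t + g' t).
    exact: gen_add.
  by move=> x Ix; apply: has_derivD; [exact: hf | exact: hg'].
- move=> f g gf [f' gf' hf] gg [g' gg' hg'].
  exists (fun t => f' t * g t + f t * g' t).
    by apply: gen_add; apply: gen_mul.
  by move=> x Ix; apply: has_derivM; [exact: hf | exact: hg'].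
Qed.

Section SmoothInTime.
Variables (R : realType) (gens : (R -> R) -> Prop) (I : set R).
Hypothesis open_I : open I.
Hypothesis gens_deriv : forall f, gens f -> exists2 f', generated gens f' &
     forall x, I x -> has_deriv x f (f' x).

Let V := (R^o * 'rV[R]_6)%type.
Let U : set V := [set p | I p.1].

Let open_U : open U.
Proof. by apply: (@open_comp _ _ fst) => // p _; exact: cvg_fst. Qed.

Let fst_diff (p : V) : differentiable (fst : V -> R^o) p.
Proof.
have : continuous (fst : V -> R^o) by move=> q; exact: cvg_fst.
exact: (@linear_differentiable _ _ _ (fst : {linear V -> R^o})).
Qed.

Lemma generated_smooth f : generated gens f ->
  smooth_on U (fun p : V => f p.1 : R^o).
Proof.
move=> gf k; elim: k f gf => [|k IH] f gf.
all: have [f' gf' df] := generated_deriv gens_deriv gf.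
  move=> p Ip; apply: (@continuous_comp _ _ _ fst f); first exact: cvg_fst.
  exact: has_deriv_continuous (df _ Ip).
have diff_f p : U p -> differentiable (f : R^o -> R^o) p.1.
  by move=> Ip; apply/derivable1_diffP; have [] := df _ Ip.
split=> [p Ip|v]; first exact: (differentiable_comp (fst_diff p) (diff_f _ Ip)).
have gv : generated gens (fun t => v.1 * f' t) by apply: gen_mul => //; exact: gen_cst.
apply: (Ck_on_ext open_U) (IH _ gv) => p; rewrite inE => Ip.
rewrite deriveE; last exact: (differentiable_comp (fst_diff p) (diff_f _ Ip)).
have -> : (fun p0 : V => f p0.1 : R^o) = (f : R^o -> R^o) \o (fst : V -> R^o) by [].
rewrite (diff_comp (fst_diff p) (diff_f _ Ip)) /=.
rewrite (@diff_lin _ _ _ (fst : {linear V -> R^o})); last by move=> q; exact: cvg_fst.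
rewrite -[X in 'd _ _ X]mulr1 [RHS]linearZ -deriveE; last exact: diff_f.
by have [_ ->] := df _ Ip.
Qed.

End SmoothInTime.

Lemma smooth_cst (R : realType) (V : normedModType R) (c : R) :
  smooth (fun _ : V => c : R^o).
Proof.
move=> k; elim: k c => [|k IH] c /=; first by move=> x _; exact: cvg_cst.
split=> [x _|v]; first exact: differentiable_cst.
rewrite (_ : (fun x => _) = fun=> 0 : R^o) //.
by apply/funext => x; rewrite derive_cst.
Qed.

Section Solutions.
Variables (R : realType) (G : lie_group R) (Gamma : set 'rV[R]_6).
Variables (e : coframe R) (dc : 'I_6 -> 'I_6 -> 'I_6 -> R).
Hypothesis hdc : forall x k i j, dcoframe e x k i j = dc k i j.

Lemma smooth_upto_continuous (T : \bar R) (f : R -> 'rV[R]_6 -> R) x t1 :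
  (t1%:E < T)%E -> smooth_upto T f -> {within `[0, t1], continuous (fun t => f t x)}.
Proof.
move=> t1T [eps e0 [F sF Ff]]; apply/subspace_continuousP => t.
rewrite /= in_itv /= => /andP[t0 tt1].
have tT s : s <= t1 -> (s%:E < T)%E by move=> st1; apply: le_lt_trans t1T; rewrite lee_fin.
have Ut : [set p : R^o * 'rV[R]_6 | - eps < p.1 /\ ((p.1 : R)%:E < T)%E] (t, x).
  split; last exact: tT.
  by rewrite /= (lt_le_trans _ t0)// oppr_lt0.
have cF : F (s, x) @[s --> t] --> F (t, x).
  have c : {for t, continuous (fun s : R^o => (s, x))}.
    by move=> A; exact: (cvg_pair (@cvg_id _ (nbhs t)) (@cvg_cst _ x _ (nbhs t) _)).
  exact: (continuous_comp c (sF 0%N (t, x) Ut)).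
have E := Ff t x t0 (tT _ tt1).
suff : f s x @[s --> within `[0, t1] (nbhs t)] --> F (t, x) by rewrite E.
have cW : F (s, x) @[s --> within `[0, t1] (nbhs t)] --> F (t, x).
  exact: cvg_within_filter.
suff fF : f s x @[s --> within `[0, t1] (nbhs t)] `=>`
          F (s, x) @[s --> within `[0, t1] (nbhs t)] by exact: cvg_trans fF cW.
apply: fmap_within_eq => s.
rewrite inE /= in_itv/= => /andP[s0 st].
by rewrite Ff// tT.
Qed.

Definition linv_family (T : \bar R) (phi : R -> 'rV[R]_6 -> form3 R) : Prop :=
  forall t x y i j k, 0 <= t -> (t%:E < T)%E -> phi t x i j k = phi t y i j k.

Lemma linv_family_cst T phi t : linv_family T phi -> 0 <= t -> (t%:E < T)%E ->
  phi t = fun=> phi t 0.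
Proof.
move=> h t0 tT; apply/funext => x; apply/funext => i; apply/funext => j.
by apply/funext => k; exact: h.
Qed.

Lemma linv_solution_unique (T T' : \bar R) phi psi :
  typeIIA_solution G Gamma e T phi -> linv_family T phi ->
  typeIIA_solution G Gamma e T' psi -> linv_family T' psi ->
  (forall x i j k, psi 0 x i j k = phi 0 x i j k) ->
  agree_before (Order.min T T') psi phi.
Proof.
move=> [sphi pphi dphi] lphi [spsi ppsi dpsi] lpsi init t1 x i j k t10.
rewrite lt_min => /andP[t1T t1T'].
rewrite (lpsi _ x 0)// (lphi _ x 0)//.
have tT s (S : \bar R) : (t1%:E < S)%E -> s <= t1 -> (s%:E < S)%E.
  by move=> t1S st; apply: le_lt_trans t1S; rewrite lee_fin.
pose I := ('I_6 * 'I_6 * 'I_6)%type.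
pose w (a : I) t := psi t 0 a.1.1 a.1.2 a.2 - phi t 0 a.1.1 a.1.2 a.2.
pose w' (a : I) t := linv_flow dc (psi t 0) a.1.1 a.1.2 a.2
                   - linv_flow dc (phi t 0) a.1.1 a.1.2 a.2.
pose Dist t := \sum_a `|w a t|.
have D0 t : t \in `[0, t1] -> 0 <= Dist t by move=> _; apply: sumr_ge0.
have pq : lip_form t1 Dist (fun t => psi t 0) (fun t => phi t 0).
  move=> a b c; split.
  - exact: (smooth_upto_continuous t1T' (spsi a b c)).
  - exact: (smooth_upto_continuous t1T (sphi a b c)).
  exists 1 => // t _; rewrite mul1r /Dist (bigD1 (a, b, c))//= lerDl.
  exact: sumr_ge0.
have hp t : t \in `[0, t1] -> positive (psi t 0).
  by rewrite in_itv/= => /andP[t0 tt]; have [_ _ + _] := ppsi t t0 (tT _ _ t1T' tt); exact.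
have hq t : t \in `[0, t1] -> positive (phi t 0).
  by rewrite in_itv/= => /andP[t0 tt]; have [_ _ + _] := pphi t t0 (tT _ _ t1T tt); exact.
have lf := lip_flow t10 pq hp hq dc.
have [C C0 hC] : exists2 C, 0 <= C & forall a t, t \in `[0, t1] -> `|w' a t| <= C * Dist t.
  have Ca (a : I) : {c | 0 <= c /\ forall t, t \in `[0, t1] -> `|w' a t| <= c * Dist t}.
    apply: cid; have [_ _ [c c0 hc]] := lf a.1.1 a.1.2 a.2.
    by exists c.
  exists (\sum_a sval (Ca a)); first by apply: sumr_ge0 => a _; have [] := svalP (Ca a).
  move=> a t tI; have [_ /(_ t tI) h] := svalP (Ca a).
  apply: (le_trans h); rewrite ler_wpM2r ?D0// (bigD1 a)//= lerDl.
  by apply: sumr_ge0 => b _; have [] := svalP (Ca b).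
suff : w (i, j, k) t1 = 0 by move/eqP; rewrite subr_eq0 => /eqP.
apply: (gronwall (w' := w') (C := C) t10 C0).
- move=> a; apply/subspace_continuousP => t tI; apply: cvgB.
    have := smooth_upto_continuous (x := 0) t1T' (spsi a.1.1 a.1.2 a.2).
    by move/subspace_continuousP; exact.
  have := smooth_upto_continuous (x := 0) t1T (sphi a.1.1 a.1.2 a.2).
  by move/subspace_continuousP; exact.
- move=> a t; rewrite in_itv/= => /andP[t0 tt].
  have rhsE S (f : R -> 'rV[R]_6 -> form3 R) : (t1%:E < S)%E -> linv_family S f ->
      typeIIA_rhs e (f t) 0 a.1.1 a.1.2 a.2 = linv_flow dc (f t 0) a.1.1 a.1.2 a.2.
    move=> t1S lS; rewrite {1}(linv_family_cst lS (ltW t0) (tT _ _ t1S (ltW tt))).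
    exact: typeIIA_rhs_cst.
  have d1 := dpsi t 0 a.1.1 a.1.2 a.2 t0 (tT _ _ t1T' (ltW tt)).
  have d2 := dphi t 0 a.1.1 a.1.2 a.2 t0 (tT _ _ t1T (ltW tt)).
  rewrite (rhsE T')// in d1; rewrite (rhsE T)// in d2.
  exact: (is_deriveB d1 d2).
- move=> a t; rewrite in_itv/= => /andP[t0 tt]; apply: hC.
  by rewrite in_itv/= !ltW.
- by move=> a; rewrite /w init subrr.
Qed.

End Solutions.

(** * From curves of 3-forms to maximal solutions *)

Section Assembly.
Variables (R : realType) (G : lie_group R) (Gamma : set 'rV[R]_6).
Variables (e : coframe R) (dc : 'I_6 -> 'I_6 -> 'I_6 -> R).
Hypothesis hdc : forall x k i j, dcoframe e x k i j = dc k i j.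

Lemma open_lifespan (eps : R) (T : \bar R) :
  open [set t : R^o | - eps < t /\ ((t : R)%:E < T)%E].
Proof.
case: T => [T| |].
- rewrite (_ : [set _ | _] = `]- eps, T[%classic); first exact: interval_open.
  by apply/seteqP; split => t /=; rewrite in_itv/= lte_fin => /andP.
- rewrite (_ : [set _ | _] = `]- eps, +oo[%classic); first exact: interval_open.
  apply/seteqP; split => t /=; rewrite in_itv/= andbT ltry; first by case.
  by [].
- rewrite (_ : [set _ | _] = set0); first exact: open0.
  by apply/seteqP; split => t //= -[_]; rewrite ltNge leNye.
Qed.

Lemma smooth_upto_generated (T : \bar R) (gens : (R -> R) -> Prop) (f : R -> R) :
  (forall g, gens g -> exists2 g', generated gens g' &
     forall x, (x%:E < T)%E -> has_deriv x g (g' x)) ->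
  generated gens f -> smooth_upto T (fun t _ => f t).
Proof.
move=> hg gf; exists 1 => //; exists (fun p => f p.1) => //.
pose I : set R := [set t | - (1 : R) < t /\ (t%:E < T)%E].
have hI g : gens g -> exists2 g', generated gens g' &
    forall x, I x -> has_deriv x g (g' x).
  by move=> /hg[g' gg' dg]; exists g' => // x [_]; exact: dg.
exact: (generated_smooth (@open_lifespan 1 T) hI gf).
Qed.

Lemma linv_typeIIA_solution (T : \bar R) (f : R -> form3 R) :
  (forall i j k, smooth_upto T (fun t _ => f t i j k)) ->
  (forall t, 0 <= t -> (t%:E < T)%E ->
     [/\ alternating (f t), positive (f t) &
       forall i j k l, linv_d3 dc (f t) i j k l = 0]) ->
  (forall t i j k, 0 < t -> (t%:E < T)%E ->
     has_deriv t (fun s => f s i j k) (linv_flow dc (f t) i j k)) ->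
  typeIIA_solution G Gamma e T (fun t _ => f t).
Proof.
move=> sf pf df; split => // [t t0 tT|t x i j k t0 tT].
  have [alt pos cl] := pf t t0 tT; split => // x i j k l.
  by rewrite (d3_cst hdc).
by rewrite (typeIIA_rhs_cst hdc); exact: df.
Qed.

Lemma linv_typeIIA_flow (T : \bar R) (f : R -> form3 R) (phi0 : form3 R) :
  (0 < T)%E -> typeIIA_solution G Gamma e T (fun t _ => f t) ->
  f 0 = phi0 ->
  (forall T' psi, (T < T')%E -> typeIIA_solution G Gamma e T' psi ->
     ~ agree_before T psi (fun t _ => f t)) ->
  typeIIA_flow G Gamma e phi0 T (fun t _ => f t).
Proof.
move=> T0 sf f0 mf; split => // [x i j k|T' psi spsi lpsi psi0]; first by rewrite f0.
apply: (linv_solution_unique hdc sf _ spsi lpsi) => // x i j k.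
by rewrite psi0 f0.
Qed.

Lemma iter_frame_deriv_cst (s : seq 'I_6) (c : R) :
  foldr (frame_deriv e) (fun=> c) s = fun=> if s is [::] then c else 0.
Proof.
elim: s => [|i s IH] //=; apply/funext => x; rewrite IH.
exact: frame_deriv_cst.
Qed.

End Assembly.

(** * The flow on the nilmanifold *)

Section NilFlow.
Variables (R : realType) (G : lie_group R) (Gamma : set 'rV[R]_6).
Variables (e : coframe R).
Hypothesis he : structure_equations e (nil_structure R).
Variables (a b : R).
Hypothesis hab : b ^+ 2 < 1 + a.

Let f (t : R) : form3 R := nil_form (a + 8%:R * t) b.

Let ft t i j k : f t i j k = nil_form a b i j k + (8%:R * e3 R 1 3 5 i j k) * t.
Proof. by rewrite /f /nil_form; ring. Qed.

Let f_ok t : 0 <= t -> b ^+ 2 < 1 + (a + 8%:R * t).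
Proof. by move=> t0; rewrite addrA (lt_le_trans hab)// lerDl mulr_ge0. Qed.

Let hdc : forall x k i j, dcoframe e x k i j = @nil_dc R k i j.
Proof. by []. Qed.

Lemma nil_typeIIA_flow : typeIIA_flow G Gamma e (nil_form a b) +oo%E (fun t _ => f t).
Proof.
apply: (linv_typeIIA_flow hdc) => //.
- apply: (linv_typeIIA_solution _ _ hdc).
  + move=> i j k.
    rewrite (_ : (fun t _ => _) = fun t (_ : 'rV[R]_6) =>
      nil_form a b i j k + (8%:R * e3 R 1 3 5 i j k) * t); last first.
      by apply/funext => t; apply/funext => x; rewrite ft.
    apply: (smooth_upto_generated (gens := fun g => g = (fun t => t))).
      by move=> g ->; exists (fun=> 1); [exact: gen_cst | move=> x _; exact: has_deriv_id].
    apply: gen_add; first exact: gen_cst.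
    by apply: gen_mul; [exact: gen_cst | exact: gen_in].
  + move=> t t0 _; split; [exact: nil_alternating (f_ok t0)|exact: nil_positive (f_ok t0)|].
    exact: nil_closed (f_ok t0).
  + move=> t i j k t0 _; rewrite nil_flow; last exact: f_ok (ltW t0).
    rewrite (_ : (fun s => f s i j k) = fun s =>
      nil_form a b i j k + (8%:R * e3 R 1 3 5 i j k) * s); last first.
      by apply/funext => s; rewrite ft.
    apply: (has_deriv_eq (has_derivD (has_deriv_cst t _) (has_derivM (has_deriv_cst t _) (has_deriv_id t)))).
    by rewrite mul0r mulr1 !add0r.
- by rewrite /f mulr0 addr0.
- by move=> T' psi; rewrite ltNge leey.
Qed.

Lemma nil_nijenhuis_cvg0 (eps : R) : 0 < eps -> exists t0 : R, forall t x,
  0 <= t -> t0 < t -> nijenhuis_norm e (fun=> f t) x < eps.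
Proof.
(* q > M makes 1 / q at most 1 and less than eps^2, so that q^{-3} < eps^2 *)
move=> eps0; pose M := 1 + eps ^-1 ^+ 2; exists (M ^+ 2 + b ^+ 2 - a) => t x t0 tM.
rewrite (nijenhuis_norm_cst hdc).
have := nil_nijenhuis_norm2 (f_ok t0) => /= ->.
set q := Num.sqrt (1 + (a + 8%:R * t) - b ^+ 2).
have M1 : 1 <= M by rewrite lerDl sqr_ge0.
have qM : M < q.
  rewrite -[M]ger0_norm ?(le_trans ler01)// -sqrtr_sqr /q ltr_sqrt.
    by move: t0 tM; lra.
  by rewrite subr_gt0 f_ok.
have q0 : 0 < q by apply: lt_le_trans (ltW qM); rewrite (lt_le_trans ltr01).
have qV0 : 0 < q^-1 by rewrite invr_gt0.
have qV1 : q^-1 <= 1 by rewrite invf_le1// (le_trans M1)// ltW.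
have qVe : q^-1 < eps ^+ 2.
  rewrite -[eps ^+ 2]invrK ltf_pV2 ?posrE ?invr_gt0 ?exprn_gt0//.
  by apply: lt_trans qM; rewrite /M -exprVn ltrDr.
rewrite -[eps]ger0_norm ?ltW// -[ltRHS]sqrtr_sqr ltr_sqrt ?exprn_gt0//.
apply: le_lt_trans qVe; rewrite -[leRHS]mulr1 exprS.
by apply: ler_wpM2l; [exact: ltW | rewrite exprn_ile1// ltW].
Qed.

End NilFlow.

(** * The flow on the solvmanifold *)

(** [P] and [Q] are the initial values of the two products.  The equation
    X' = Y' = c X Y has the solution X = P / h, Y = Q exp (c (P - Q) t) / h,
    because X - Y stays equal to P - Q; when P = Q the function h is affine. *)
Lemma blow_up_profile (R : realType) (P Q c : R) : 0 < P -> 0 < Q -> 0 < c ->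
  exists (T : R) (h : R -> R),
    [/\ 0 < T, h 0 = 1 /\ h T = 0,
        (forall t, has_deriv t h (- (c * Q * expR (c * (P - Q) * t)))),
        (forall t, P = Q * expR (c * (P - Q) * t) + (P - Q) * h t) &
        (forall t, t < T -> 0 < h t)].
Proof.
move=> P0 Q0 c0; set k := P - Q.
have pos (T : R) (h : R -> R) :
    (forall t, has_deriv t h (- (c * Q * expR (c * k * t)))) -> h T = 0 ->
    forall t, t < T -> 0 < h t.
  move=> dh hT t tT.
  have cont : {within `[t, T], continuous h}.
    by apply: continuous_subspaceT => x; exact: has_deriv_continuous (dh x).
  (* h is decreasing and vanishes at T *)
  have [x _] := MVT tT (fun x _ => dh x) cont.
  rewrite hT sub0r mulNr => /oppr_inj ->.
  by rewrite mulr_gt0 ?subr_gt0// mulr_gt0 ?expR_gt0// mulr_gt0.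
have [k0|k0] := eqVneq k 0.
  pose h t := 1 + - (c * Q) * t.
  have dh t : has_deriv t h (- (c * Q * expR (c * k * t))).
    rewrite k0 mulr0 mul0r expR0 mulr1.
    apply: (has_deriv_eq (has_derivD (has_deriv_cst t 1) (has_derivM (has_deriv_cst t (- (c * Q))) (has_deriv_id t)))).
    by ring.
  have hT : h (c * Q)^-1 = 0.
    by rewrite /h mulNr mulfV ?subrr// gt_eqF// mulr_gt0.
  exists (c * Q)^-1, h; split => //.
  - by rewrite invr_gt0 mulr_gt0.
  - by split => //; rewrite /h mulr0 addr0.
  - move=> t; rewrite k0 mulr0 mul0r mul0r expR0 mulr1 addr0.
    by apply/eqP; rewrite -subr_eq0; apply/eqP.
  - exact: pos.
pose h t := P / k + - (Q / k) * expR (c * k * t).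
have dh t : has_deriv t h (- (c * Q * expR (c * k * t))).
  apply: (has_deriv_eq (has_derivD (has_deriv_cst t _) (has_derivM (has_deriv_cst t _) (has_deriv_exp t (c * k))))).
  by field.
have PQ0 : 0 < P / Q by rewrite divr_gt0.
pose T : R := ln (P / Q) / (c * k).
have hT : h T = 0.
  have ck0 : c * k != 0 by rewrite mulf_neq0// gt_eqF.
  rewrite /h /T mulrCA mulfV// mulr1.
  by rewrite lnK ?posrE//; field; rewrite k0 gt_eqF.
exists T, h; split => //.
- rewrite /T; have [kp|kn|] := ltgtP k 0; last by move/eqP; rewrite (negPf k0).
    rewrite -mulrNN -invrN mulr_gt0// ?invr_gt0 ?oppr_gt0; last first.
      by rewrite pmulr_rlt0.
    by apply: ln_lt0; rewrite PQ0 ltr_pdivrMr// mul1r -subr_lt0.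
  by rewrite divr_gt0 ?mulr_gt0// ln_gt0// ltr_pdivlMr// mul1r -subr_gt0.
- by split=> //; rewrite /h mulr0 expR0; rewrite /k in k0 *; field.
- by move=> t; rewrite /h; field.
- exact: pos.
Qed.

Lemma sol_constant_gt0 (R : realType) : 0 < sol_constant R.
Proof.
apply: ln_gt0; rewrite ltr_pdivlMr// mul1r.
by have := sqrtr_ge0 (5%:R : R); lra.
Qed.

Definition sol_rate (R : realType) : R := 32%:R * sol_constant R ^+ 2.

Lemma sol_rate_gt0 (R : realType) : 0 < sol_rate R.
Proof. by rewrite mulr_gt0// exprn_gt0// sol_constant_gt0. Qed.

(** K is quadratic and sqrt (- lambda) is homogeneous of degree 2. *)
Lemma J_form_scale (R : realType) (m : R) (phi : form3 R) : 0 < m ->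
  J_form (fun i j k => m * phi i j k) = J_form phi.
Proof.
move=> m0; set psi := fun i j k => _.
have KE : K_form psi = m ^+ 2 *: K_form phi.
  apply/matrixP => i v; rewrite !mxE mulrN mulrCA; congr (- (_ * _)).
  do 5![rewrite mulr_sumr; apply: eq_bigr => ? _].
  by rewrite /psi; ring.
have lE : - lambda_form psi = (m ^+ 2) ^+ 2 * - lambda_form phi.
  rewrite /lambda_form KE -scalemxAl -scalemxAr !mxtraceZ; ring.
rewrite /J_form lE KE sqrtrM ?sqr_ge0// sqrtr_sqr ger0_norm ?sqr_ge0//.
rewrite scalerA invfM mulrAC mulVf ?mul1r//.
by rewrite expf_neq0// gt_eqF.
Qed.

Lemma cvg_pev (R : realType) (T : Type) (F : set_system T) (FF : Filter F)
    (fs : seq (T -> R)) (ls : seq R) (p : pol) :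
  (forall n, nth (fun=> 0) fs n x @[x --> F] --> nth 0 ls n) ->
  size fs = size ls ->
  pev [seq f x | f <- fs] p @[x --> F] --> pev ls p.
Proof.
move=> hf hs.
have cm m : mev [seq f x | f <- fs] m @[x --> F] --> mev ls m.
  elim: m fs ls hf hs => [|n m IH] [|f fs'] [|l ls'] //= hf hs; try exact: cvg_cst.
  apply: cvgM; last by apply: IH; [move=> i; exact: (hf i.+1) | case: hs].
  have fl := hf 0%N.
  elim: n => [|n IHn]; first by rewrite expr0; exact: cvg_cst.
  by rewrite exprS; under eq_fun do rewrite exprS; exact: cvgM.
elim: p => [|[c m] p IH] /=; first exact: cvg_cst.
by apply: cvgD => //; apply: cvgM => //; exact: cvg_cst.
Qed.

Lemma has_deriv_sol_form (R : realType) (A B C D : R -> R) (A' B' C' D' x : R) i j k :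
  has_deriv x A A' -> has_deriv x B B' -> has_deriv x C C' -> has_deriv x D D' ->
  has_deriv x (fun t => sol_form (A t) (B t) (C t) (D t) i j k) (sol_form A' B' C' D' i j k).
Proof.
move=> dA dB dC dD.
have c y := has_deriv_cst x y.
rewrite (_ : (fun t => _) = fun t =>
  A t * (e3 R 1 3 5 i j k + e3 R 1 3 6 i j k)
  + B t * (e3 R 1 4 5 i j k - e3 R 1 4 6 i j k)
  + C t * (e3 R 2 3 5 i j k - e3 R 2 3 6 i j k)
  + D t * - (e3 R 2 4 5 i j k + e3 R 2 4 6 i j k)); last first.
  by apply/funext => t; rewrite /sol_form mulrN.
apply: (has_deriv_eq (has_derivD (has_derivD (has_derivD (has_derivM dA (c _)) (has_derivM dB (c _)))
  (has_derivM dC (c _))) (has_derivM dD (c _)))).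
by rewrite /sol_form; ring.
Qed.

Lemma generated_sol_form (R : realType) gens (A B C D : R -> R) i j k :
  generated gens A -> generated gens B -> generated gens C -> generated gens D ->
  generated gens (fun t => sol_form (A t) (B t) (C t) (D t) i j k).
Proof.
move=> gA gB gC gD.
rewrite (_ : (fun t => _) = fun t =>
  A t * (e3 R 1 3 5 i j k + e3 R 1 3 6 i j k)
  + B t * (e3 R 1 4 5 i j k - e3 R 1 4 6 i j k)
  + C t * (e3 R 2 3 5 i j k - e3 R 2 3 6 i j k)
  + D t * - (e3 R 2 4 5 i j k + e3 R 2 4 6 i j k)); last first.
  by apply/funext => t; rewrite /sol_form mulrN.
by apply: gen_add; first (apply: gen_add; first apply: gen_add);
  (apply: gen_mul => //; exact: gen_cst).
Qed.

Lemma sol_form_135 (R : realType) (A B C D : R) :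
  sol_form A B C D (inord 0) (inord 2) (inord 4) = A.
Proof.
rewrite (sol_rep A B C D [::]) !inordK//.
transitivity (pev (sol_env A B C D [::]) (pvar 0)); last by rewrite pev_var.
by apply: (@peq_modP _ _ [::]) => //; vm_compute.
Qed.

(** Written with the logarithm, so that the chain rule for [ln] and [expR]
    gives its derivative. *)
Definition inv_sqrt (R : realType) (h : R -> R) (t : R) : R :=
  expR (- 2%:R^-1 * ln (h t)).

(** A square root of the exponential in [blow_up_profile]. *)
Definition sol_drift (R : realType) (A B C D t : R) : R :=
  expR (sol_rate R * (A * D - B * C) / 2%:R * t).

Definition sol_direction (R : realType) (A B C D t : R) : form3 R :=
  sol_form A (B * sol_drift A B C D t) (C * sol_drift A B C D t) D.

Definition sol_solution (R : realType) (A B C D : R) (h : R -> R) (t : R) :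
    form3 R :=
  let m := inv_sqrt h t in let E := sol_drift A B C D t in
  sol_form (A * m) (B * (E * m)) (C * (E * m)) (D * m).

Section SolFlow.
Variables (R : realType) (G : lie_group R) (Gamma : set 'rV[R]_6).
Variables (e : coframe R).
Hypothesis he : structure_equations e (sol_structure R).
Variables (A B C D : R).
Hypothesis hpos : same_sign A B C D.

Let hdc : forall x k i j, dcoframe e x k i j = @sol_dc R k i j.
Proof. by []. Qed.

Local Notation P := (A * D).
Local Notation Q := (B * C).
Local Notation c := (sol_rate R).
Local Notation k := (P - Q).

Let P_gt0 : 0 < P. Proof. by case: hpos. Qed.
Let Q_gt0 : 0 < Q.
Proof.
have := same_sign_prod hpos; rewrite (_ : _ * D = P * Q); last by ring.
by rewrite pmulr_rgt0.
Qed.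
Variables (T : R) (h : R -> R).
Hypotheses (T_gt0 : 0 < T) (h0 : h 0 = 1) (hT : h T = 0).
Hypothesis dh : forall t, has_deriv t h (- (c * Q * expR (c * k * t))).
Hypothesis Ph : forall t, P = Q * expR (c * k * t) + k * h t.
Hypothesis h_gt0 : forall t, t < T -> 0 < h t.

Local Notation m := (inv_sqrt h).
Local Notation E := (sol_drift A B C D).
Local Notation f := (sol_solution A B C D h).

Let m_gt0 t : 0 < m t. Proof. exact: expR_gt0. Qed.
Let E_gt0 t : 0 < E t. Proof. exact: expR_gt0. Qed.

Let E2 t : E t * E t = expR (c * k * t).
Proof. by rewrite /sol_drift -expRD; congr expR; field. Qed.

Let m2 t : t < T -> m t * m t * h t = 1.
Proof.
move=> tT; rewrite /inv_sqrt -expRD -{3}[h t]lnK ?posrE ?h_gt0// -expRD.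
by rewrite (_ : _ + _ = 0) ?expR0//; field.
Qed.

Let dE t : has_deriv t E (c * k / 2%:R * E t).
Proof. exact: has_deriv_exp. Qed.

Let dm t : t < T -> has_deriv t m (c * Q / 2%:R * (E t * E t) * (m t * m t * m t)).
Proof.
move=> tT; have ht := h_gt0 tT.
have dl := has_deriv_comp (dh t) (is_derive1_ln ht).
have := has_deriv_comp (has_derivM (has_deriv_cst t (- 2%:R^-1)) dl) (is_derive_expR _).
move=> d; apply: (has_deriv_eq d).
have -> : (h t)^-1 = m t * m t.
  by apply: (mulIf (lt0r_neq0 ht)); rewrite mulVf ?gt_eqF// m2.
by rewrite E2 /inv_sqrt; field.
Qed.

Let f_same_sign t : same_sign (A * m t) (B * (E t * m t)) (C * (E t * m t)) (D * m t).
Proof.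
have Em : 0 < E t * m t by rewrite mulr_gt0.
by case: hpos => AB AC AD; split; rewrite mulrACA mulr_gt0// mulr_gt0.
Qed.

Let df t i j l : t < T -> has_deriv t (fun s => f s i j l) (linv_flow (@sol_dc R) (f t) i j l).
Proof.
move=> tT; rewrite sol_flow; last exact: f_same_sign.
have c16 : 16%:R * sol_constant R ^+ 2 = c / 2%:R by rewrite /sol_rate; field.
have Pm : P * (m t * m t) = Q * (E t * E t) * (m t * m t) + k.
  rewrite {1}(Ph t) -E2 mulrDl; congr (_ + _).
  by rewrite -mulrA (mulrC (h t)) m2// mulr1.
have dEm := has_derivM (dE t) (dm tT).
rewrite c16; apply: has_deriv_sol_form.
- apply: (has_deriv_eq (has_derivM (has_deriv_cst t A) (dm tT))); by field.
- apply: (has_deriv_eq (has_derivM (has_deriv_cst t B) dEm)).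
  transitivity (c / 2%:R * (B * (E t * m t)) * (P * (m t * m t))); last first.
    by field.
  by rewrite Pm; field.
- apply: (has_deriv_eq (has_derivM (has_deriv_cst t C) dEm)).
  transitivity (c / 2%:R * (C * (E t * m t)) * (P * (m t * m t))); last first.
    by field.
  by rewrite Pm; field.
- apply: (has_deriv_eq (has_derivM (has_deriv_cst t D) (dm tT))); by field.
Qed.

Let f_solution : typeIIA_solution G Gamma e T%:E (fun t _ => f t).
Proof.
apply: (linv_typeIIA_solution _ _ hdc).
- move=> i j l.
  apply: (smooth_upto_generated (gens := fun g => g = m \/ g = E)).
    have gm : generated (fun g => g = m \/ g = E) m by apply: gen_in; left.
    have gE : generated (fun g => g = m \/ g = E) E by apply: gen_in; right.
    move=> g [] ->.
      exists (fun t => c * Q / 2%:R * (E t * E t) * (m t * m t * m t)).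
        by do ![apply: gen_mul => //]; exact: gen_cst.
      by move=> t; rewrite lte_fin; exact: dm.
    exists (fun t => c * k / 2%:R * E t); last by move=> t _; exact: dE.
    by apply: gen_mul => //; exact: gen_cst.
  have gm : generated (fun g => g = m \/ g = E) m by apply: gen_in; left.
  have gE : generated (fun g => g = m \/ g = E) E by apply: gen_in; right.
  by apply: generated_sol_form; (apply: gen_mul; [exact: gen_cst|]) => //; exact: gen_mul.
- move=> t _ _; have ft := f_same_sign t.
  by split; [exact: sol_alternating | exact: sol_positive | exact: sol_closed].
- by move=> t i j l _; rewrite lte_fin; exact: df.
Qed.

Let f135 t : f t (inord 0) (inord 2) (inord 4) = A * m t.
Proof. exact: sol_form_135. Qed.

(** The coefficient w of e^{135} is A / sqrt h before T; if it had a finite limit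
    at T, then w^2 h = A^2 would give A = 0, as h vanishes at T. *)
Let f_maximal (T' : \bar R) psi : (T%:E < T')%E ->
  typeIIA_solution G Gamma e T' psi -> ~ agree_before T%:E psi (fun t _ => f t).
Proof.
move=> TT' [spsi _ _] agree.
have cw := smooth_upto_continuous (x := 0) TT' (spsi (inord 0) (inord 2) (inord 4)).
pose w t := psi t 0 (inord 0) (inord 2) (inord 4).
have /(continuous_within_itvP _ T_gt0)[_ _ wT] : {within `[0, T], continuous w} by [].
have hcT : h @ T^'- --> 0.
  by rewrite -hT; apply: cvg_at_left_filter; exact: has_deriv_continuous (dh T).
have g0 : (w t * w t * h t) @[t --> T^'-] --> w T * w T * 0 by do !apply: cvgM.
have gA : (w t * w t * h t) @[t --> T^'-] --> A ^+ 2.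
  have nA : \forall t \near T^'-, A ^+ 2 = w t * w t * h t.
    near=> t.
    have tT : t < T by near: t; exact: nbhs_left_lt.
    have t0 : 0 <= t by near: t; exact: nbhs_left_ge.
    rewrite /w agree ?lte_fin// f135.
    rewrite (_ : _ * h t = A ^+ 2 * (m t * m t * h t)); last by ring.
    by rewrite m2// mulr1.
  have cA : (fun=> A ^+ 2) t @[t --> T^'-] --> A ^+ 2 by exact: cvg_cst.
  have nAcvg := near_eq_cvg nA.
  by apply: cvg_trans cA; exact: nAcvg.
have : A ^+ 2 = 0.
  by rewrite -(mulr0 (w T * w T)); apply: cvg_unique gA g0.
move/eqP; rewrite sqrf_eq0 => /eqP A0.
by case: hpos; rewrite A0 mul0r ltxx.
Unshelve. all: by end_near. Qed.

Lemma sol_typeIIA_flow : typeIIA_flow G Gamma e (sol_form A B C D) T%:E (fun t _ => f t).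
Proof.
apply: (linv_typeIIA_flow hdc) => //.
by rewrite /sol_solution /inv_sqrt /sol_drift h0 ln1 !mulr0 expR0 !mulr1.
Qed.

Local Notation fn := (sol_direction A B C D).

Let J_fn t : J_form (f t) = J_form (fn t).
Proof.
rewrite -(J_form_scale (fn t) (m_gt0 t)); congr J_form.
apply/funext => i; apply/funext => j; apply/funext => l.
by rewrite /sol_solution /sol_direction /sol_form; ring.
Qed.

Let fn_same_sign t : same_sign A (B * E t) (C * E t) D.
Proof. by case: hpos => AB AC AD; split; rewrite // mulrA mulr_gt0. Qed.

Let J_cvg i j : J_form (fn t) i j @[t --> T] --> J_form (fn T) i j.
Proof.
pose r t := (Num.sqrt (A * (B * E t) * (C * E t) * D))^-1.
pose fs : seq (R -> R) := [:: fun=> A; fun t => B * E t; fun t => C * E t;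
  fun=> D; r; fun=> sol_constant R].
have Efs t : J_form (fn t) i j = pev [seq g t | g <- fs] (geoJ sol_ms sol_ph sol_pis i j).
  exact: (sol_J_rep (fn_same_sign t) [::]).
rewrite Efs (_ : (fun t => _) = fun t => pev [seq g t | g <- fs]
  (geoJ sol_ms sol_ph sol_pis i j)); last by apply/funext => t; rewrite Efs.
have cE : E t @[t --> T] --> E T by exact: has_deriv_continuous (dE T).
have cB (x : R) : x * E t @[t --> T] --> x * E T.
  by apply: cvgM => //; exact: cvg_cst.
apply: cvg_pev => // -[|[|[|[|[|[|n]]]]]] /=; rewrite ?nth_nil;
  try exact: cvg_cst; try exact: cB.
apply: cvgV; first by rewrite gt_eqF// sqrtr_gt0 same_sign_prod.
apply: cvg_comp; last exact: sqrt_continuous.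
by do ![apply: cvgM => //]; try exact: cvg_cst; exact: cB.
Qed.

Lemma sol_J_cvg :
  cvg_at e T (fun t _ => J_form (f t)) (fun=> J_form (fn T)).
Proof.
move=> s i j eps eps0.
have /cvgrPdist_lt/(_ eps eps0) := @J_cvg i j.
move=> [d /= d0 hd]; exists (T - d) => [|t x tT0 tT]; first by rewrite ltrBlDr ltrDl.
rewrite iter_frame_deriv_cst J_fn; case: s => [|? ?]; last by rewrite normr0.
rewrite distrC; apply: hd => /=.
by rewrite ger0_norm ?subr_ge0 ?ltW// ltrBlDr -ltrBlDl.
Qed.

Lemma sol_limit_harmonic : harmonic_acs G Gamma e (fun=> J_form (fn T)).
Proof.
have bal : A * D = B * E T * (C * E T).
  by rewrite mulrACA E2 {1}(Ph T) hT mulr0 addr0.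
have hs := fn_same_sign T.
have [_ _ pd] := sol_positive hs.
split => //.
- by move=> i j; exact: smooth_cst.
- by move=> x; exact: (sol_J_sq hs bal).
- move=> x i j; apply/eqP; rewrite mulf_eq0 subr_eq0; apply/orP; right; apply/eqP.
  rewrite (ricci_cst hdc) (sol_ricci_invariant hs bal).
  by do 2![apply: eq_bigr => ? _]; rewrite (ricci_cst hdc).
Qed.

End SolFlow.

Theorem theorem11 (R : realType) (G : lie_group R) (Gamma : set 'rV[R]_6)
    (e : coframe R) (hGamma : cocompact_lattice G Gamma)
    (he : left_invariant_coframe G e) :
  (structure_equations e (nil_structure R) ->
   forall a b : R, positive (nil_form a b) ->
   exists2 phi : R -> 'rV[R]_6 -> form3 R,
     typeIIA_flow G Gamma e (nil_form a b) +oo%E phi &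
     forall eps : R, 0 < eps -> exists t0 : R, forall t x, 0 <= t -> t0 < t ->
       nijenhuis_norm e (phi t) x < eps)
  /\
  (structure_equations e (sol_structure R) ->
   forall al be ga de : R, positive (sol_form al be ga de) ->
   exists (T : R) (phi : R -> 'rV[R]_6 -> form3 R),
     typeIIA_flow G Gamma e (sol_form al be ga de) T%:E phi /\
     exists2 Jlim : 'rV[R]_6 -> 'M[R]_6,
       cvg_at e T (fun t x => J_form (phi t x)) Jlim &
       harmonic_acs G Gamma e Jlim).
Proof.
split=> [hnil a b [_ l0 _] | hsol A B C D /positive_same_sign hpos].
  have hab : b ^+ 2 < 1 + a.
    by move: l0; rewrite nil_lambda oppr_lt0 (pmulr_rgt0 _ (ltr0n R 4)) subr_gt0.
  exists (fun t _ => nil_form (a + 8%:R * t) b); first exact: nil_typeIIA_flow.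
  by move=> eps eps0; exact: nil_nijenhuis_cvg0.
have P0 : 0 < A * D by case: hpos.
have Q0 : 0 < B * C.
  have := same_sign_prod hpos.
  rewrite (_ : _ * D = A * D * (B * C)); last by ring.
  by rewrite pmulr_rgt0.
have [T [h [T0 [h0 hT] dh Ph h_gt0]]] := blow_up_profile P0 Q0 (sol_rate_gt0 R).
eexists; eexists; split.
  exact: (sol_typeIIA_flow G Gamma hsol hpos T0 h0 hT dh Ph h_gt0).
by eexists; [exact: sol_J_cvg | exact: (sol_limit_harmonic G Gamma hsol hpos hT Ph)].
Qed.
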